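(* Let $k$ be a field. (a) The functor $\otimes^*\colon\mathsf{Top}^{\mathsf s}_k\times\mathsf{Top}^{\mathsf s}_k\to\mathsf{Top}^{\mathsf s}_k$ preserves the kernels and cokernels of morphisms (in each of its arguments). Fixing a topological vector space in one of the arguments, it becomes an exact endofunctor $\mathsf{Top}^{\mathsf s}_k\to\mathsf{Top}^{\mathsf s}_k$ in the other argument (with respect to the quasi-abelian exact structure on $\mathsf{Top}^{\mathsf s}_k$). (b) The functor $\otimes^{\leftarrow}\colon\mathsf{Top}^{\mathsf s}_k\times\mathsf{Top}^{\mathsf s}_k\to\mathsf{Top}^{\mathsf s}_k$ preserves the kernels and cokernels of morphisms (in each of its arguments). Fixing a topological vector space in any one of the arguments, it becomes an exact endofunctor $\mathsf{Top}^{\mathsf s}_k\to\mathsf{Top}^{\mathsf s}_k$ in the other argument (with respect to the quasi-abelian exact structure on $\mathsf{Top}^{\mathsf s}_k$). (c) The functor $\otimes^!\colon\mathsf{Top}^{\mathsf s}_k\times\mathsf{Top}^{\mathsf s}_k\to\mathsf{Top}^{\mathsf s}_k$ preserves the kernels and cokernels of morphisms (in each of its arguments). Fixing a topological vector space in one of the arguments, it becomes an exact endofunctor $\mathsf{Top}^{\mathsf s}_k\to\mathsf{Top}^{\mathsf s}_k$ in the other argument (with respect to the quasi-abelian exact structure on $\mathsf{Top}^{\mathsf s}_k$).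
   Context: All topological $k$-vector spaces ($k$ a fixed field with the discrete topology) have linear topology: open vector subspaces form a base of neighborhoods of zero. A topological vector space is separated if the intersection of all its open subspaces is zero. $\mathsf{Top}^{\mathsf s}_k$ is the category of separated (not necessarily complete) topological $k$-vector spaces and continuous $k$-linear maps. It is additive; the kernel of a morphism is the vector space kernel with the induced topology, and the cokernel of $f\colon A\to B$ is the quotient $B/\overline{f(A)}$ of $B$ by the closure of the image, with the quotient topology. $\mathsf{Top}^{\mathsf s}_k$ is quasi-abelian: the class of all short sequences $0\to A'\overset{i}\to A\overset{p}\to A''\to0$ in which $i$ is a kernel of $p$ and $p$ is a cokernel of $i$ is a (Quillen) exact category structure, called the quasi-abelian exact structure. An additive functor between exact categories is exact if it takes short exact sequences to short exact sequences. For topological vector spaces $U$ and $V$, three linear topologies on $U\otimes_kV$ are defined as follows; the resulting topological vector spaces are denoted by $U\otimes^*V$, $U\otimes^{\leftarrow}V$, $U\otimes^!V$ (they are separated when $U$ and $V$ are). A subspace $E\subset U\otimes_kV$ is open in $U\otimes^*V$ if: there exist open subspaces $P\subset U$, $Q\subset V$ with $P\otimes_kQ\subset E$; for every $u\in U$ there is an open subspace $Q_u\subset V$ with $u\otimes Q_u\subset E$; and for every $v\in V$ there is an open subspace $P_v\subset U$ with $P_v\otimes v\subset E$. A subspace $E$ is open in $U\otimes^{\leftarrow}V$ if: there exists an open subspace $P\subset U$ with $P\otimes_kV\subset E$; and for every $u\in U$ there is an open subspace $Q_u\subset V$ with $u\otimes Q_u\subset E$. A subspace $E$ is open in $U\otimes^!V$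 if there exist open subspaces $P\subset U$, $Q\subset V$ with $P\otimes_kV+U\otimes_kQ\subset E$. On morphisms all three functors are given by $(f,g)\mapsto f\otimes g$. *)

(* Defs.v *)
From HB Require Import structures.
From mathcomp Require Import all_boot all_algebra generic_quotient.
From mathcomp Require Import boolp classical_sets topology.
From mathcomp.multinomials Require Import freeg.

Set Implicit Arguments.
Unset Strict Implicit.
Unset Printing Implicit Defensive.

Import GRing.Theory.

Local Open Scope classical_set_scope.
Local Open Scope quotient_scope.
Local Open Scope ring_scope.

Definition lsubspace (k : fieldType) (V : lmodType k) (E : set V) : Prop :=
  E 0 /\ forall (a : k) (x y : V), E x -> E y -> E (a *: x + y).
Arguments lsubspace {k V} E.
Section SubspaceTheory.
Context (k : fieldType).
Implicit Types V W : lmodType k.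

Lemma lsubspaceD V (E : set V) x y : lsubspace E -> E x -> E y -> E (x + y).
Proof. by move=> [_ h] Ex Ey; rewrite -[x]scale1r; exact: h. Qed.

Lemma lsubspaceZ V (E : set V) a x : lsubspace E -> E x -> E (a *: x).
Proof. by move=> [h0 h] Ex; rewrite -[_ *: _]addr0; exact: h. Qed.

Lemma lsubspaceN V (E : set V) x : lsubspace E -> E x -> E (- x).
Proof. by move=> hE Ex; rewrite -scaleN1r; exact: lsubspaceZ. Qed.

Lemma lsubspaceB V (E : set V) x y : lsubspace E -> E x -> E y -> E (x - y).
Proof. by move=> hE Ex Ey; apply: lsubspaceD => //; exact: lsubspaceN. Qed.

Lemma lsubspaceT V : lsubspace (@setT V).
Proof. by split. Qed.

Lemma lsubspaceI V (E F : set V) : lsubspace E -> lsubspace F -> lsubspace (E `&` F).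
Proof.
move=> [E0 hE] [F0 hF]; split=> // a x y [Ex Fx] [Ey Fy].
by split; [exact: hE|exact: hF].
Qed.

Lemma lsubspace_preimage V W (f : {linear V -> W}) (E : set W) :
  lsubspace E -> lsubspace (f @^-1` E).
Proof.
move=> [E0 hE]; split=> [|a x y Ex Ey]; first by rewrite /preimage/= linear0.
by rewrite /preimage/= linearP; exact: hE.
Qed.

Lemma smallest_lsubspace V (S : set V) : lsubspace (smallest lsubspace S).
Proof.
split=> [E [[]]//|a x y hx hy E hE].
by apply: hE.1.2; [exact: hx|exact: hy].
Qed.

Lemma smallest_lsubspace_le V (S E : set V) :
  lsubspace E -> (smallest lsubspace S `<=` E) <-> (S `<=` E).
Proof.
move=> hE; split; last by move=> SE; exact: smallest_sub.
by apply: subset_trans; exact: sub_gen_smallest.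
Qed.

Lemma lsubspace_functional V (E : set V) (v : V) : lsubspace E -> ~ E v ->
  exists2 phi : {linear V -> k^o}, (forall x, E x -> phi x = 0) & phi v = 1.
Proof.
move=> hE nEv.
pose P (M : set V) := [/\ lsubspace M, E `<=` M & ~ M v].
pose P' (M : set V) := M = set0 \/ P M.
have [F FP totF|M [PM maxM]] := @Zorn_bigcup V P'.
  have [[M0 [FM0 PM0]]|noP] := pselect (exists M, F M /\ P M); last first.
    left; apply/seteqP; split=> // x [M FM Mx].
    have [M0|PM] := FP _ FM; first by move: Mx; rewrite M0.
    by case: noP; exists M.
  right; split.
  - split; first by exists M0 => //; case: PM0 => -[].
    move=> a x y [M FM Mx] [N FN Ny].
    have [MN|NM] := totF _ _ FM FN.
      have [N0|[[_ hN] _ _]] := FP _ FN; first by move: Ny; rewrite N0.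
      by exists N => //; apply: hN => //; exact: MN.
    have [M0'|[[_ hM] _ _]] := FP _ FM; first by move: Mx; rewrite M0'.
    by exists M => //; apply: hM => //; exact: NM.
  - by move=> x Ex; exists M0 => //; case: PM0 => _ + _; apply.
  - move=> [M FM Mv]; have [M0'|[_ _]//] := FP _ FM.
    by move: Mv; rewrite M0'.
have {PM}[hM EM nMv] : P M.
  case: PM => // M0; exfalso; apply: (maxM E); last by right; split.
  by rewrite M0; split=> [x []|/(_ 0)]; case: hE => E0 _ /(_ E0).
have coef x : exists a : k, M (x - a *: v).
  have [Mx|nMx] := pselect (M x); first by exists 0; rewrite scale0r subr0.
  pose N := [set y | exists b : k, M (y - b *: x)].
  have hN : lsubspace N.
    split; first by exists 0; rewrite scale0r subr0; case: hM.
    move=> a y z [b hb] [c hc]; exists (a * b + c).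
    rewrite scalerDl opprD addrACA -scalerA -scalerBr.
    by apply: hM.2.
  have MN : M `<=` N by move=> y My; exists 0; rewrite scale0r subr0.
  have Nx : N x by exists 1; rewrite scale1r subrr; case: hM.
  have [b Mb] : N v.
    apply: contrapT => nNv; apply: (maxM N); last first.
      by right; split=> //; exact: subset_trans MN.
    by split=> // /(_ _ Nx).
  have b0 : b != 0.
    by apply/eqP => b0; apply: nMv; move: Mb; rewrite b0 scale0r subr0.
  exists b^-1; rewrite -[X in X - _]scale1r -(mulVf b0) -scalerA -scalerBr.
  by rewrite -opprB scalerN; apply: lsubspaceN => //; exact: lsubspaceZ.
have coef_uniq x a b : M (x - a *: v) -> M (x - b *: v) -> a = b.
  move=> Ma Mb; apply/eqP; rewrite -subr_eq0; apply/eqP.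
  have Mab : M ((a - b) *: v).
    rewrite scalerBl.
    have -> : a *: v - b *: v = (x - b *: v) - (x - a *: v).
      by rewrite opprB addrCA addrAC subrr add0r addrC.
    exact: lsubspaceB.
  apply: contrapT => /eqP ab0; apply: nMv.
  by rewrite -[v]scale1r -(mulVf ab0) -scalerA; exact: lsubspaceZ.
pose phi x : k^o := projT1 (cid (coef x)).
have phiP x : M (x - phi x *: v) by exact: projT2 (cid (coef x)).
have phi_lin : linear phi.
  move=> a x y; apply: (@coef_uniq (a *: x + y)) => //.
  rewrite scalerDl opprD addrACA -scalerA -scalerBr.
  by apply: hM.2.
pose L := GRing.isLinear.Build k V k^o _ phi phi_lin.
pose philin : {linear V -> k^o} := HB.pack phi L.
exists philin => [x Ex|] /=; apply: coef_uniq (phiP _) _.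
- by rewrite scale0r subr0; exact: EM.
- by rewrite scale1r subrr; case: hM.
Qed.

End SubspaceTheory.

HB.mixin Record isLinearTopology (k : fieldType) V
    & Topological V & GRing.Lmodule k V := {
  add_continuous : continuous (fun x : V * V => x.1 + x.2);
  scale_continuous :
    continuous (fun x : discrete_topology k * V => (x.1 : k) *: x.2);
  nbhs0_open_subspace : forall A : set V, nbhs (0 : V) A ->
    exists E : set V, [/\ open E, lsubspace E & E `<=` A]
}.

#[short(type="linTopType")]
HB.structure Definition LinearTopology (k : fieldType) :=
  {V of Topological V & GRing.Lmodule k V & isLinearTopology k V}.

HB.mixin Record isSeparatedLinearTopology (k : fieldType) V
    & LinearTopology k V := {
  separated0 : forall x : V,
    (forall E : set V, open E -> lsubspace E -> E x) -> x = 0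
}.

#[short(type="sepLinTopType")]
HB.structure Definition SeparatedLinearTopology (k : fieldType) :=
  {V of LinearTopology k V & isSeparatedLinearTopology k V}.

Definition open_subspace (k : fieldType) (V : linTopType k) (E : set V) :=
  open E /\ lsubspace E.

Section LinTopTheory.
Context (k : fieldType).
Implicit Types V W : linTopType k.

Lemma open_subspaceT V : open_subspace (@setT V).
Proof. by split; [exact: openT|exact: lsubspaceT]. Qed.

Lemma open_subspaceI V (E F : set V) :
  open_subspace E -> open_subspace F -> open_subspace (E `&` F).
Proof.
by move=> [oE sE] [oF sF]; split; [exact: openI|exact: lsubspaceI].
Qed.

Lemma nbhs_translate V (x y : V) (A : set V) :
  nbhs (x + y) A -> nbhs y [set z | A (x + z)].
Proof.
move=> nA.
have /= c := @continuous_comp V (V * V)%type V (fun z => (x, z))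
  (fun p => p.1 + p.2) y _ (@add_continuous k V _).
by apply: c nA; apply: cvg_pair => /=; [exact: cvg_cst|exact: cvg_id].
Qed.

Lemma open_subspace_nbhs V (x : V) (A : set V) : nbhs x A <->
  exists2 E, open_subspace E & forall e, E e -> A (x + e).
Proof.
split.
  rewrite -{1}[x]addr0 => /nbhs_translate /nbhs0_open_subspace.
  by move=> [E [oE sE EA]]; exists E.
move=> [E [oE sE] EA].
have : nbhs 0 E by apply: open_nbhs_nbhs; split=> //; case: sE.
rewrite -{1}[0](addNr x) => /nbhs_translate.
by apply: filterS => z /EA /=; rewrite addrA subrr add0r.
Qed.

Lemma linear_continuousP V W (f : {linear V -> W}) : continuous f <->
  forall E, open_subspace E -> open_subspace (f @^-1` E).
Proof.
split=> [cf E [oE sE]|h x A].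
  split; last exact: lsubspace_preimage.
  by apply: open_comp => // y _; exact: cf.
move=> /open_subspace_nbhs[E hE EA].
apply/open_subspace_nbhs; exists (f @^-1` E); first exact: h.
by move=> e Ee /=; rewrite linearD; exact: EA.
Qed.

End LinTopTheory.

(* The separated linear topology in which the open subspaces are the members
   of a given separated filter of subspaces. *)
Record sepFilter (k : fieldType) (W : lmodType k) := SepFilter {
  sepFilter_set :> set W -> Prop;
  sepFilter_subspace : forall E, sepFilter_set E -> lsubspace E;
  sepFilterT : sepFilter_set setT;
  sepFilterI : forall E F,
    sepFilter_set E -> sepFilter_set F -> sepFilter_set (E `&` F);
  sepFilterS : forall E F,
    sepFilter_set E -> lsubspace F -> E `<=` F -> sepFilter_set F;
  sepFilter_sep : forall x, (forall E, sepFilter_set E -> E x) -> x = 0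
}.

Definition topologized (k : fieldType) (W : lmodType k) (B : sepFilter W) :
  Type := W.

Section Topologized.
Context (k : fieldType) (W : lmodType k) (B : sepFilter W).
Local Notation T := (topologized B).

HB.instance Definition _ := GRing.Lmodule.on T.

Definition topologized_open : set_system T :=
  [set A | forall x, A x -> exists2 E, B E & forall e, E e -> A (x + e)].

Lemma topologized_openT : topologized_open setT.
Proof. by move=> x _; exists setT => //; exact: sepFilterT. Qed.

Lemma topologized_openI : setI_closed topologized_open.
Proof.
move=> A C oA oC x [/oA[E BE EA] /oC[F BF FC]].
exists (E `&` F); first exact: sepFilterI.
by move=> e [Ee Fe]; split; [exact: EA|exact: FC].
Qed.

Lemma topologized_open_bigU (I : Type) (f : I -> set T) :
  (forall i, topologized_open (f i)) -> topologized_open (\bigcup_i f i).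
Proof.
move=> of_ x [i _ /of_[E BE Ef]].
by exists E => // e /Ef ?; exists i.
Qed.

HB.instance Definition _ := isOpenTopological.Build T
  topologized_openT topologized_openI topologized_open_bigU.

Lemma topologized_openE (A : set T) : open A = topologized_open A.
Proof. by []. Qed.

Lemma topologized_open_mem (E : set T) : B E -> open E.
Proof.
move=> BE; rewrite topologized_openE => x Ex; exists E => // e Ee.
by apply: lsubspaceD => //; exact: sepFilter_subspace BE.
Qed.

Lemma topologized_nbhs (x : T) (A : set T) :
  nbhs x A <-> exists2 E, B E & forall e, E e -> A (x + e).
Proof.
rewrite nbhsE; split.
  by move=> [O [oO Ox] OA]; have [E BE EO] := oO _ Ox; exists E => // e /EO/OA.
move=> [E BE EA]; have sE := sepFilter_subspace BE.
exists [set y | E (y - x)].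
  split; last by rewrite /= subrr; case: sE.
  rewrite topologized_openE => y /= Ey; exists E => // e Ee.
  by rewrite addrAC; exact: lsubspaceD.
by move=> y /= /EA; rewrite addrC subrK.
Qed.

Lemma topologized_add_continuous : continuous (fun x : T * T => x.1 + x.2).
Proof.
move=> [x y] A /topologized_nbhs[E BE EA]; have sE := sepFilter_subspace BE.
exists ([set z | E (z - x)], [set z | E (z - y)]).
  by split; apply/topologized_nbhs; exists E => // e Ee /=;
    rewrite addrAC subrr add0r.
move=> [x' y'] [/= Ex Ey].
have -> : x' + y' = (x + y) + ((x' - x) + (y' - y)).
  by rewrite addrACA !(addrC x) subrK (addrC y) subrK.
by apply: EA; exact: lsubspaceD.
Qed.

Lemma topologized_scale_continuous :
  continuous (fun x : discrete_topology k * T => (x.1 : k) *: x.2).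
Proof.
move=> [a x] A /topologized_nbhs[E BE EA]; have sE := sepFilter_subspace BE.
exists ([set a], [set z | E (z - x)]).
  split; first exact: discrete_set1.
  by apply/topologized_nbhs; exists E => // e Ee /=; rewrite addrAC subrr add0r.
move=> [_ y] [/= -> Ey].
have -> : (a : k) *: y = (a : k) *: x + (a : k) *: (y - x).
  by rewrite -scalerDr addrC subrK.
by apply: EA; exact: lsubspaceZ.
Qed.

Lemma topologized_nbhs0 (A : set T) : nbhs (0 : T) A ->
  exists E : set T, [/\ open E, lsubspace E & E `<=` A].
Proof.
move=> /topologized_nbhs[E BE EA]; exists E; split.
- exact: topologized_open_mem.
- exact: sepFilter_subspace BE.
- by move=> e /EA; rewrite add0r.
Qed.

HB.instance Definition _ := isLinearTopology.Build k T
  topologized_add_continuous topologized_scale_continuous topologized_nbhs0.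

Lemma topologized_open_subspace (E : set T) : open_subspace E <-> B E.
Proof.
split=> [[oE sE]|BE]; last first.
  by split; [exact: topologized_open_mem|exact: sepFilter_subspace BE].
have [F BF FE] := oE _ sE.1; apply: sepFilterS BF sE _ => e /FE.
by rewrite add0r.
Qed.

Lemma topologized_separated0 (x : T) :
  (forall E : set T, open E -> lsubspace E -> E x) -> x = 0.
Proof.
move=> h; apply: (@sepFilter_sep _ _ B) => E BE.
by apply: h; [exact: topologized_open_mem|exact: sepFilter_subspace BE].
Qed.

HB.instance Definition _ :=
  isSeparatedLinearTopology.Build k T topologized_separated0.

End Topologized.

Section FreeLift.
Context (k : fieldType) (X : choiceType) (M : lmodType k) (f : X -> M).

Lemma fglift_sum (D : {freeg X / k}) :
  fglift f D = \sum_(x <- dom D) coeff x D *: f x.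
Proof.
rewrite -{1}(Freeg_dom D) fglift_Freeg /prelift big_map.
by apply: eq_bigr.
Qed.

Lemma fgliftB (D1 D2 : {freeg X / k}) :
  fglift f (D1 - D2) = fglift f D1 - fglift f D2.
Proof. exact: lift_is_additive. Qed.

Lemma fglift_linear : linear (fglift f : {freeg X / k} -> M).
Proof.
pose A := GRing.isZmodMorphism.Build {freeg X / k} M (fglift f)
  (@lift_is_additive _ _ _ f).
pose F : {additive {freeg X / k} -> M} := HB.pack (fglift f) A.
have FE D : F D = fglift f D by [].
move=> a D1 D2; rewrite -FE raddfD; congr (_ + _).
have -> : a *: D1 = \sum_(x <- dom D1) << a * coeff x D1 *g x >> by [].
rewrite raddf_sum fglift_sum scaler_sumr; apply: eq_bigr => x _.
by rewrite FE liftU scalerA.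
Qed.

End FreeLift.

Section Tensor.
Context (k : fieldType) (U V : lmodType k).
Local Notation F := {freeg (U * V) / k}.

Definition bilinearity_relations : set F :=
  [set x | exists (a : k) (u u' : U) (v : V),
     x = << (a *: u + u', v) >> - (a *: << (u, v) >> + << (u', v) >>)] `|`
  [set x | exists (a : k) (u : U) (v v' : V),
     x = << (u, a *: v + v') >> - (a *: << (u, v) >> + << (u, v') >>)].

Definition tensor_eq (x y : F) : bool :=
  `[< smallest lsubspace bilinearity_relations (x - y) >].

Let relS := @smallest_lsubspace k F bilinearity_relations.

Lemma tensor_eq_equiv : equiv_class_of tensor_eq.
Proof.
split=> [x|x y|y x z].
- by apply/asboolP; rewrite subrr; case: relS.
- by apply/asboolP/asboolP => h; rewrite -opprB; exact: (lsubspaceN relS h).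
- move=> /asboolP xy /asboolP yz; apply/asboolP.
  by rewrite -(subrK y x) -addrA; exact: (lsubspaceD relS xy yz).
Qed.

Canonical tensor_equiv := EquivRelPack tensor_eq_equiv.

Definition tensor : Type := {eq_quot tensor_eq}.
HB.instance Definition _ := Choice.on tensor.
HB.instance Definition _ := EqQuotient.on tensor.

Lemma tensor_piP (x y : F) :
  \pi_tensor x = \pi_tensor y <->
  smallest lsubspace bilinearity_relations (x - y).
Proof.
split=> [/eqP|h]; first by rewrite piE => /asboolP.
by apply/eqP; rewrite piE; apply/asboolP.
Qed.

Lemma tensor_reprP (x : F) :
  smallest lsubspace bilinearity_relations (repr (\pi_tensor x) - x).
Proof. by apply/tensor_piP; rewrite reprK. Qed.

Definition tensor_zero : tensor := \pi_tensor 0.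
Definition tensor_opp (x : tensor) : tensor := \pi_tensor (- repr x).
Definition tensor_add (x y : tensor) : tensor := \pi_tensor (repr x + repr y).
Definition tensor_scale (a : k) (x : tensor) : tensor := \pi_tensor (a *: repr x).

Lemma tensor_pi_opp (x : F) : tensor_opp (\pi_tensor x) = \pi_tensor (- x).
Proof.
by apply/tensor_piP; rewrite -opprD; apply: (lsubspaceN relS); exact: tensor_reprP.
Qed.

Lemma tensor_pi_add (x y : F) : tensor_add (\pi_tensor x) (\pi_tensor y) = \pi_tensor (x + y).
Proof.
apply/tensor_piP; rewrite opprD addrACA.
by apply: (lsubspaceD relS); exact: tensor_reprP.
Qed.

Lemma tensor_pi_scale a (x : F) : tensor_scale a (\pi_tensor x) = \pi_tensor (a *: x).
Proof.
apply/tensor_piP; rewrite -scalerBr.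
by apply: (lsubspaceZ _ relS); exact: tensor_reprP.
Qed.

Lemma tensor_addA : associative tensor_add.
Proof.
elim/quotW=> x; elim/quotW=> y; elim/quotW=> z.
by rewrite (tensor_pi_add x y) (tensor_pi_add y z) !tensor_pi_add addrA.
Qed.

Lemma tensor_addC : commutative tensor_add.
Proof.
by elim/quotW=> x; elim/quotW=> y; rewrite !tensor_pi_add addrC.
Qed.

Lemma tensor_add0 : left_id tensor_zero tensor_add.
Proof. by elim/quotW=> x; rewrite !tensor_pi_add add0r. Qed.

Lemma tensor_addN : left_inverse tensor_zero tensor_opp tensor_add.
Proof.
by elim/quotW=> x; rewrite tensor_pi_opp tensor_pi_add addNr.
Qed.

HB.instance Definition _ := GRing.isZmodule.Build tensor
  tensor_addA tensor_addC tensor_add0 tensor_addN.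

Lemma tensor_scaleA a b x :
  tensor_scale a (tensor_scale b x) = tensor_scale (a * b) x.
Proof. by elim/quotW: x => x; rewrite (tensor_pi_scale b x) !tensor_pi_scale scalerA. Qed.

Lemma tensor_scale1 : left_id 1 tensor_scale.
Proof. by elim/quotW=> x; rewrite tensor_pi_scale scale1r. Qed.

Lemma tensor_scaleDr : right_distributive tensor_scale +%R.
Proof.
move=> a; elim/quotW=> x; elim/quotW=> y.
have addE (p q : tensor) : p + q = tensor_add p q by [].
by rewrite !addE tensor_pi_add !tensor_pi_scale scalerDr tensor_pi_add.
Qed.

Lemma tensor_scaleDl x : {morph tensor_scale^~ x : a b / a + b}.
Proof.
move=> a b; elim/quotW: x => x.
have addE (p q : tensor) : p + q = tensor_add p q by [].
by rewrite !addE !tensor_pi_scale scalerDl tensor_pi_add.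
Qed.

HB.instance Definition _ := GRing.Zmodule_isLmodule.Build k tensor
  tensor_scaleA tensor_scale1 tensor_scaleDr tensor_scaleDl.

Lemma tensor_pi0 : \pi_tensor 0 = 0.
Proof. by []. Qed.

Lemma tensor_piD (x y : F) : \pi_tensor (x + y) = \pi_tensor x + \pi_tensor y.
Proof. by rewrite -tensor_pi_add. Qed.

Lemma tensor_piZ a (x : F) : \pi_tensor (a *: x) = a *: \pi_tensor x.
Proof. by rewrite -tensor_pi_scale. Qed.

Definition tmul (u : U) (v : V) : tensor := \pi_tensor << (u, v) >>.

Lemma tmul_linearl v : linear (tmul^~ v).
Proof.
move=> a u u'; rewrite /tmul -tensor_piZ -tensor_piD; apply/tensor_piP.
by apply: sub_gen_smallest; left; exists a, u, u', v.
Qed.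

Lemma tmul_linearr u : linear (tmul u).
Proof.
move=> a v v'; rewrite /tmul -tensor_piZ -tensor_piD; apply/tensor_piP.
by apply: sub_gen_smallest; right; exists a, u, v, v'.
Qed.

HB.instance Definition _ u := GRing.isLinear.Build k V tensor _ (tmul u)
  (tmul_linearr u).

Lemma tmulDl u u' v : tmul (u + u') v = tmul u v + tmul u' v.
Proof. by rewrite -[u]scale1r tmul_linearl !scale1r. Qed.

Lemma tmul0l v : tmul 0 v = 0.
Proof. by apply: (addrI (tmul 0 v)); rewrite -tmulDl !addr0. Qed.

Lemma tmulZl a u v : tmul (a *: u) v = a *: tmul u v.
Proof. by rewrite -[a *: u]addr0 tmul_linearl tmul0l addr0. Qed.

Lemma tensor_sum (t : tensor) :
  exists s : seq (U * V), t = \sum_(p <- s) tmul p.1 p.2.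
Proof.
elim/quotW: t => x; rewrite -(freeg_sumE x).
exists [seq (coeff p x *: p.1, p.2) | p <- dom x].
rewrite [RHS]big_map; elim: (dom x) => [|p s IH]; first by rewrite !big_nil tensor_pi0.
rewrite !big_cons tensor_piD IH tmulZl /tmul -tensor_piZ -surjective_pairing.
congr (\pi_tensor _ + _); apply/eqP/freeg_eqP => q.
by rewrite coeffZ !coeffU mul1r.
Qed.

Lemma tensor_ind (P : set tensor) : lsubspace P ->
  (forall u v, P (tmul u v)) -> forall t, P t.
Proof.
move=> sP Pt t; have [s ->] := tensor_sum t.
elim: s => [|p s IH]; first by rewrite big_nil; case: sP.
by rewrite big_cons; exact: lsubspaceD.
Qed.

Section Lift.
Context (M : lmodType k) (b : U -> V -> M).
Hypothesis bl : forall v, linear (b^~ v).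
Hypothesis br : forall u, linear (b u).

Definition tensor_lift (t : tensor) : M :=
  fglift (fun p => b p.1 p.2) (repr t).

Lemma tensor_lift_pi x : tensor_lift (\pi_tensor x) = fglift (fun p => b p.1 p.2) x.
Proof.
apply/eqP; rewrite -subr_eq0 -fgliftB; apply/eqP.
pose K := [set y : F | fglift (fun p => b p.1 p.2) y = 0].
apply: (_ : smallest lsubspace bilinearity_relations `<=` K); last first.
  exact: tensor_reprP.
have lin := @fglift_linear k _ M (fun p => b p.1 p.2).
have f0 : fglift (fun p => b p.1 p.2) (0 : F) = 0 by rewrite -(subrr 0) fgliftB subrr.
apply: smallest_sub.
  split=> // a y z; rewrite /K/= => y0 z0.
  by rewrite lin y0 z0 scaler0 addr0.
move=> _ [[a [u [u' [v ->]]]]|[a [u [v [v' ->]]]]]; rewrite /K/=.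
  by rewrite fgliftB lin !liftU !scale1r /= bl subrr.
by rewrite fgliftB lin !liftU !scale1r /= br subrr.
Qed.

Lemma tensor_lift_linear : linear tensor_lift.
Proof.
move=> a; elim/quotW=> x; elim/quotW=> y.
by rewrite -tensor_piZ -tensor_piD !tensor_lift_pi fglift_linear.
Qed.

Lemma tensor_liftE u v : tensor_lift (tmul u v) = b u v.
Proof. by rewrite tensor_lift_pi liftU scale1r. Qed.

End Lift.

End Tensor.

Notation "u '\ox' v" := (tmul u v) (at level 40, left associativity) : ring_scope.

Section TensorMap.
Context (k : fieldType).

Section Def.
Context (U U' V V' : lmodType k) (f : {linear U -> U'}) (g : {linear V -> V'}).

Definition tensor_map : tensor U V -> tensor U' V' :=
  tensor_lift (fun u v => f u \ox g v).

Lemma tensor_map_bilinl v : linear (fun u => f u \ox g v).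
Proof. by move=> a u u'; rewrite linearP tmul_linearl. Qed.

Lemma tensor_map_bilinr u : linear (fun v => f u \ox g v).
Proof. by move=> a v v'; rewrite linearP tmul_linearr. Qed.

Lemma tensor_map_linear : linear tensor_map.
Proof.
exact: tensor_lift_linear tensor_map_bilinl tensor_map_bilinr.
Qed.

HB.instance Definition _ :=
  GRing.isLinear.Build k (tensor U V) (tensor U' V') _ tensor_map
    tensor_map_linear.

Lemma tensor_mapE u v : tensor_map (u \ox v) = f u \ox g v.
Proof.
exact: tensor_liftE tensor_map_bilinl tensor_map_bilinr _ _.
Qed.

End Def.

Lemma tensor_linear_ext (U V W : lmodType k) (f g : {linear tensor U V -> W}) :
  (forall u v, f (u \ox v) = g (u \ox v)) -> f =1 g.
Proof.
move=> fg; apply: tensor_ind => //; split; first by rewrite !linear0.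
by move=> a x y; rewrite !linearP => -> ->.
Qed.

End TensorMap.

Section TensorTopologies.
Context (k : fieldType).

(* The image of P \otimes_k Q in U \otimes_k V. *)
Definition tensor_sub (U V : lmodType k) (P : set U) (Q : set V) :
    set (tensor U V) :=
  smallest lsubspace [set u \ox v | u in P & v in Q].

(* star, larrow and shriek stand for \otimes^*, \otimes^{\leftarrow} and
   \otimes^!. *)
Section Opens.
Context (U V : linTopType k).
Implicit Type E : set (tensor U V).

Definition star_open E : Prop :=
  [/\ lsubspace E,
      exists P Q, [/\ open_subspace P, open_subspace Q &
        tensor_sub P Q `<=` E],
      forall u : U, exists2 Q, open_subspace Q & [set u \ox v | v in Q] `<=` E &
      forall v : V, exists2 P, open_subspace P & [set u \ox v | u in P] `<=` E].

Definition larrow_open E : Prop :=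
  [/\ lsubspace E,
      exists2 P, open_subspace P & tensor_sub P [set: V] `<=` E &
      forall u : U, exists2 Q, open_subspace Q & [set u \ox v | v in Q] `<=` E].

Definition shriek_open E : Prop :=
  lsubspace E /\
  exists P Q, [/\ open_subspace P, open_subspace Q &
    [set x + y | x in tensor_sub P [set: V] & y in tensor_sub [set: U] Q]
      `<=` E].

Lemma tensor_sub_le (P : set U) (Q : set V) E : lsubspace E ->
  (tensor_sub P Q `<=` E) <-> (forall u v, P u -> Q v -> E (u \ox v)).
Proof.
move=> sE; rewrite /tensor_sub smallest_lsubspace_le//; split=> [PQE u v Pu Qv|h].
  by apply: PQE; exists u => //; exists v.
by move=> _ [u Pu [v Qv <-]]; exact: h.
Qed.

Lemma star_openE E : star_open E <->
  [/\ lsubspace E,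
      exists P Q, [/\ open_subspace P, open_subspace Q &
        forall u v, P u -> Q v -> E (u \ox v)],
      forall u : U, exists2 Q : set V, open_subspace Q &
        forall v, Q v -> E (u \ox v) &
      forall v : V, exists2 P : set U, open_subspace P &
        forall u, P u -> E (u \ox v)].
Proof.
split=> -[sE [P [Q [oP oQ PQ]]] hu hv].
  split=> //; first by exists P, Q; split=> //; apply/tensor_sub_le.
  - move=> u; have [R oR RE] := hu u; exists R => // v Rv.
    by apply: RE; exists v.
  - move=> v; have [R oR RE] := hv v; exists R => // u Ru.
    by apply: RE; exists u.
split=> //; first by exists P, Q; split=> //; apply/tensor_sub_le.
- by move=> u; have [R oR RE] := hu u; exists R => // _ [v /RE ? <-].
- by move=> v; have [R oR RE] := hv v; exists R => // _ [u /RE ? <-].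
Qed.

Lemma larrow_openE E : larrow_open E <->
  [/\ lsubspace E,
      exists2 P : set U, open_subspace P & forall u v, P u -> E (u \ox v) &
      forall u : U, exists2 Q : set V, open_subspace Q &
        forall v, Q v -> E (u \ox v)].
Proof.
split=> -[sE [P oP PE] hu]; split=> //.
- by exists P => // u v Pu; exact: ((tensor_sub_le P setT sE).1 PE).
- move=> u; have [R oR RE] := hu u; exists R => // v Rv.
  by apply: RE; exists v.
- by exists P => //; apply/tensor_sub_le => // u v Pu _; exact: PE.
- by move=> u; have [R oR RE] := hu u; exists R => // _ [v /RE ? <-].
Qed.

Lemma shriek_openE E : shriek_open E <->
  lsubspace E /\
  exists P Q, [/\ open_subspace P, open_subspace Q,
    forall u v, P u -> E (u \ox v) & forall u v, Q v -> E (u \ox v)].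
Proof.
split=> -[sE [P [Q []]]].
  move=> oP oQ PQ; split=> //; exists P, Q; split=> // u v h.
    suff PE : tensor_sub P setT `<=` E by exact: ((tensor_sub_le _ _ sE).1 PE).
    move=> x Px; apply: PQ; exists x => //; exists 0; last by rewrite addr0.
    exact: (smallest_lsubspace _).1.
  suff QE : tensor_sub setT Q `<=` E by exact: ((tensor_sub_le _ _ sE).1 QE).
  move=> y Qy; apply: PQ; exists 0; first exact: (smallest_lsubspace _).1.
  by exists y => //; rewrite add0r.
move=> oP oQ PE QE; split=> //; exists P, Q; split=> // _ [x Px [y Qy <-]].
apply: lsubspaceD => //.
  by apply: ((tensor_sub_le P setT sE).2 _ x Px) => u v Pu _; exact: PE.
by apply: ((tensor_sub_le setT Q sE).2 _ y Qy) => u v _ Qv; exact: QE.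
Qed.

Lemma shriek_larrow E : shriek_open E -> larrow_open E.
Proof.
move=> /shriek_openE[sE [P [Q [oP oQ PE QE]]]]; apply/larrow_openE.
by split=> //; [exists P|move=> u; exists Q => // v; exact: QE].
Qed.

Lemma larrow_star E : larrow_open E -> star_open E.
Proof.
move=> /larrow_openE[sE [P oP PE] hu]; apply/star_openE; split=> //.
  by exists P, setT; split=> // [|u v Pu _]; [exact: open_subspaceT|exact: PE].
by move=> v; exists P => // u; exact: PE.
Qed.

Lemma star_openT : star_open setT.
Proof.
apply: larrow_star; apply: shriek_larrow; split; first exact: lsubspaceT.
by exists setT, setT; split=> //; exact: open_subspaceT.
Qed.

Lemma larrow_openT : larrow_open setT.
Proof.
apply: shriek_larrow; split; first exact: lsubspaceT.
by exists setT, setT; split=> //; exact: open_subspaceT.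
Qed.

Lemma shriek_openT : shriek_open setT.
Proof.
split; first exact: lsubspaceT.
by exists setT, setT; split=> //; exact: open_subspaceT.
Qed.

Lemma star_openI E E' : star_open E -> star_open E' -> star_open (E `&` E').
Proof.
move=> /star_openE[sE [P [Q [oP oQ PQ]]] hu hv].
move=> /star_openE[sE' [P' [Q' [oP' oQ' PQ']]] hu' hv']; apply/star_openE.
split; first exact: lsubspaceI.
- exists (P `&` P'), (Q `&` Q'); split; [exact: open_subspaceI..|].
  by move=> u v [? ?] [? ?]; split; [exact: PQ|exact: PQ'].
- move=> u; have [R oR RE] := hu u; have [R' oR' RE'] := hu' u.
  exists (R `&` R'); first exact: open_subspaceI.
  by move=> v [? ?]; split; [exact: RE|exact: RE'].
- move=> v; have [R oR RE] := hv v; have [R' oR' RE'] := hv' v.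
  exists (R `&` R'); first exact: open_subspaceI.
  by move=> u [? ?]; split; [exact: RE|exact: RE'].
Qed.

Lemma larrow_openI E E' :
  larrow_open E -> larrow_open E' -> larrow_open (E `&` E').
Proof.
move=> /larrow_openE[sE [P oP PE] hu] /larrow_openE[sE' [P' oP' PE'] hu'].
apply/larrow_openE; split; first exact: lsubspaceI.
- exists (P `&` P'); first exact: open_subspaceI.
  by move=> u v [? ?]; split; [exact: PE|exact: PE'].
- move=> u; have [R oR RE] := hu u; have [R' oR' RE'] := hu' u.
  exists (R `&` R'); first exact: open_subspaceI.
  by move=> v [? ?]; split; [exact: RE|exact: RE'].
Qed.

Lemma shriek_openI E E' :
  shriek_open E -> shriek_open E' -> shriek_open (E `&` E').
Proof.
move=> /shriek_openE[sE [P [Q [oP oQ PE QE]]]].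
move=> /shriek_openE[sE' [P' [Q' [oP' oQ' PE' QE']]]].
apply/shriek_openE; split; first exact: lsubspaceI.
exists (P `&` P'), (Q `&` Q'); split; [exact: open_subspaceI..| |].
  by move=> u v [? ?]; split; [exact: PE|exact: PE'].
by move=> u v [? ?]; split; [exact: QE|exact: QE'].
Qed.

Lemma star_openS E E' :
  star_open E -> lsubspace E' -> E `<=` E' -> star_open E'.
Proof.
move=> [_ [P [Q [oP oQ PQ]]] hu hv] sE' EE'; split=> //.
- by exists P, Q; split=> //; exact: subset_trans EE'.
- by move=> u; have [R oR RE] := hu u; exists R => //; exact: subset_trans EE'.
- by move=> v; have [R oR RE] := hv v; exists R => //; exact: subset_trans EE'.
Qed.

Lemma larrow_openS E E' :
  larrow_open E -> lsubspace E' -> E `<=` E' -> larrow_open E'.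
Proof.
move=> [_ [P oP PE] hu] sE' EE'; split=> //.
- by exists P => //; exact: subset_trans EE'.
- by move=> u; have [R oR RE] := hu u; exists R => //; exact: subset_trans EE'.
Qed.

Lemma shriek_openS E E' :
  shriek_open E -> lsubspace E' -> E `<=` E' -> shriek_open E'.
Proof.
move=> [_ [P [Q [oP oQ PQ]]]] sE' EE'; split=> //.
by exists P, Q; split=> //; exact: subset_trans EE'.
Qed.

End Opens.

Section Separation.
Context (U V : sepLinTopType k).

Lemma functional_separation (W : sepLinTopType k) (w : W) :
  (forall phi : {linear W -> k^o},
     open_subspace [set x | phi x = 0] -> phi w = 0) -> w = 0.
Proof.
move=> h; apply: separated0 => E oE sE; apply: contrapT => nEw.
have [phi phiE phiw] := lsubspace_functional sE nEw.
suff : phi w = 0 by rewrite phiw => /eqP; rewrite oner_eq0.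
apply: h; split; last first.
  have -> : [set x | phi x = 0] = phi @^-1` [set 0] by [].
  apply: lsubspace_preimage; split=> // a x y /= -> ->.
  by rewrite scaler0 addr0.
rewrite openE => x /= phix; apply/open_subspace_nbhs; exists E => // e Ee /=.
by rewrite linearD phix phiE// addr0.
Qed.

Lemma shriek_open_sep (t : tensor U V) :
  (forall E, shriek_open E -> E t) -> t = 0.
Proof.
move=> ht.
pose cont (W : sepLinTopType k) (phi : {linear W -> k^o}) :=
  open_subspace [set x | phi x = 0].
pose b (phi : {linear U -> k^o}) (psi : {linear V -> k^o}) u v : k^o :=
  phi u * psi v.
have bl phi psi v : linear (fun u => b phi psi u v).
  by move=> a u u'; rewrite /b linearP mulrDl -mulrA.
have br phi psi u : linear (b phi psi u).
  by move=> a v v'; rewrite /b linearP mulrDr mulrCA.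
have {}ht phi psi : cont U phi -> cont V psi -> tensor_lift (b phi psi) t = 0.
  move=> cphi cpsi.
  apply: (ht [set t | tensor_lift (b phi psi) t = 0]); apply/shriek_openE.
  have lin := tensor_lift_linear (bl phi psi) (br phi psi).
  split.
    split=> [|a x y /= hx hy]; last by rewrite lin hx hy scaler0 addr0.
    by have := lin (-1) 0 0; rewrite scaler0 addr0 scaleN1r addNr.
  exists [set x | phi x = 0], [set x | psi x = 0]; split=> // u v /= h.
    by rewrite tensor_liftE// /b h mul0r.
  by rewrite tensor_liftE// /b h mulr0.
have [s tE] := tensor_sum t.
have {}ht phi psi : cont U phi -> cont V psi ->
    \sum_(p <- s) phi p.1 * psi p.2 = 0.
  move=> cphi cpsi; apply: etrans (ht phi psi cphi cpsi); rewrite tE.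
  pose L := GRing.isLinear.Build k (tensor U V) k^o _ (tensor_lift (b phi psi))
    (tensor_lift_linear (bl phi psi) (br phi psi)).
  pose F : {linear tensor U V -> k^o} := HB.pack (tensor_lift (b phi psi)) L.
  rewrite -[RHS]/(F _) raddf_sum; apply: eq_bigr => p _.
  by rewrite /F/= tensor_liftE.
rewrite {t}tE; move: {2}(size s) (leqnn (size s)) => n.
elim: n => [|n IH] in s ht *.
  by rewrite leqn0 => /nilP ->; rewrite big_nil.
case: s ht => [|[u v] s] ht /= sn; first by rewrite big_nil.
have [u0|u0] := eqVneq u 0.
  rewrite big_cons /= u0 tmul0l add0r; apply: IH => // phi psi cphi cpsi.
  by have := ht phi psi cphi cpsi; rewrite big_cons /= u0 linear0 mul0r add0r.
have [phi [cphi phiu]] : exists phi : {linear U -> k^o}, cont U phi /\ phi u = 1.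
  apply: contrapT => h; move/eqP: u0; apply; apply: functional_separation => phi cphi.
  apply: contrapT => /eqP phiu; apply: h.
  pose c : k := phi u.
  exists (c^-1 \*: phi); split; last by rewrite /= /GRing.scale/= mulVf.
  rewrite /cont; suff -> : [set x | (c^-1 \*: phi) x = 0] = [set x | phi x = 0] by [].
  apply/seteqP; split=> x /=; last by move=> ->; rewrite scaler0.
  by move/eqP; rewrite scaler_eq0 invr_eq0 (negbTE phiu) /= => /eqP.
have vE : v = - \sum_(p <- s) phi p.1 *: p.2.
  apply/eqP; rewrite -addr_eq0; apply/eqP; apply: functional_separation => psi cpsi.
  have := ht phi psi cphi cpsi; rewrite big_cons /= phiu mul1r => <-.
  by rewrite linearD raddf_sum; congr (_ + _); apply: eq_bigr => p _; exact: (linearZ_LR psi).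
pose s' := [seq (p.1 - (phi p.1 : k) *: u, p.2) | p <- s].
have tE : \sum_(p <- (u, v) :: s) p.1 \ox p.2 = \sum_(p <- s') p.1 \ox p.2.
  rewrite big_cons big_map /= vE raddfN raddf_sum /= -sumrN -big_split /=.
  apply: eq_bigr => p _; rewrite tmulDl -scaleNr tmulZl scaleNr linearZ addrC.
  by [].
rewrite tE; apply: IH; last by rewrite size_map.
move=> phi' psi cphi' cpsi; apply: etrans (ht phi' psi cphi' cpsi).
rewrite big_cons big_map /=.
rewrite vE raddfN raddf_sum /= mulrN mulr_sumr -sumrN -big_split /=.
apply: eq_bigr => p _; rewrite linearB (linearZ_LR phi') mulrBl [RHS]addrC (linearZ_LR psi).
by congr (_ - _); rewrite /GRing.scale /= mulrCA mulrA.
Qed.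

Definition star_filter : sepFilter (tensor U V) := @SepFilter k (tensor U V)
  (@star_open U V) (fun E h => let: And4 s _ _ _ := h in s)
  (star_openT U V) (@star_openI U V) (@star_openS U V)
  (fun t h => shriek_open_sep
     (fun E oE => h E (larrow_star (shriek_larrow oE)))).

Definition larrow_filter : sepFilter (tensor U V) := @SepFilter k (tensor U V)
  (@larrow_open U V) (fun E h => let: And3 s _ _ := h in s)
  (larrow_openT U V) (@larrow_openI U V) (@larrow_openS U V)
  (fun t h => shriek_open_sep (fun E oE => h E (shriek_larrow oE))).

Definition shriek_filter : sepFilter (tensor U V) := @SepFilter k (tensor U V)
  (@shriek_open U V) (fun E h => h.1)
  (shriek_openT U V) (@shriek_openI U V) (@shriek_openS U V)
  shriek_open_sep.

Definition star_space : sepLinTopType k := topologized star_filter.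
Definition larrow_space : sepLinTopType k := topologized larrow_filter.
Definition shriek_space : sepLinTopType k := topologized shriek_filter.

End Separation.

End TensorTopologies.

Record clin (k : fieldType) (A B : linTopType k) := CLin {
  clin_fun :> A -> B;
  clin_linear : linear clin_fun;
  clin_continuous : continuous clin_fun
}.

Arguments clin_linear {k A B} _.
Arguments clin_continuous {k A B} _ x _ _ : rename.

HB.instance Definition _ (k : fieldType) (A B : linTopType k) (f : clin A B) :=
  GRing.isLinear.Build k A B _ f (clin_linear f).

Section Clin.
Context (k : fieldType).
Implicit Types A B C : linTopType k.

Lemma clinP A B (f g : clin A B) : f =1 g -> f = g.
Proof.
case: f g => [f lf cf] [g lg cg] /= /funext fg; subst g.
by congr CLin; exact: Prop_irrelevance.
Qed.

Lemma clin_open_preimage A B (f : clin A B) (E : set B) :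
  open_subspace E -> open_subspace (f @^-1` E).
Proof. exact: ((linear_continuousP f).1 (clin_continuous f) E). Qed.

Definition clin_id A : clin A A :=
  @CLin k A A idfun (fun a x y => erefl) (fun x => cvg_id).

Lemma clin_comp_linear A B C (g : clin B C) (f : clin A B) : linear (g \o f).
Proof. by move=> a x y; rewrite /= !linearP. Qed.

Lemma clin_comp_continuous A B C (g : clin B C) (f : clin A B) :
  continuous (g \o f).
Proof. by move=> x; apply: continuous_comp; exact: clin_continuous. Qed.

Definition clin_comp A B C (g : clin B C) (f : clin A B) : clin A C :=
  CLin (clin_comp_linear g f) (@clin_comp_continuous A B C g f).

Lemma clin_zero_linear A B : linear (\0 : A -> B).
Proof. by move=> a x y; rewrite /= scaler0 addr0. Qed.

Lemma clin_zero_continuous A B : continuous (\0 : A -> B).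
Proof. by move=> x; exact: cvg_cst. Qed.

Lemma clin_add_linear A B (f g : clin A B) : linear (f \+ g).
Proof. by move=> a x y; rewrite /= !linearP scalerDr addrACA. Qed.

Lemma clin_add_continuous A B (f g : clin A B) : continuous (f \+ g).
Proof.
move=> x; apply: (@continuous_comp A (B * B)%type B (fun x => (f x, g x))
  (fun p => p.1 + p.2)); last exact: add_continuous.
by apply: cvg_pair => /=; exact: clin_continuous.
Qed.

Lemma clin_opp_linear A B (f : clin A B) : linear (\- f).
Proof. by move=> a x y; rewrite /= linearP opprD scalerN. Qed.

Lemma clin_opp_continuous A B (f : clin A B) : continuous (\- f).
Proof.
apply/(linear_continuousP (\- f)) => E oE.
suff -> : (\- f) @^-1` E = f @^-1` E by exact: clin_open_preimage.
apply/seteqP; split=> x; rewrite /preimage /= => /(lsubspaceN oE.2) //.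
by rewrite opprK.
Qed.

Context (A B : linTopType k).
HB.instance Definition _ := gen_eqMixin (clin A B).
HB.instance Definition _ := gen_choiceMixin (clin A B).

Definition clin_zero : clin A B := CLin (@clin_zero_linear A B) (@clin_zero_continuous A B).
Definition clin_opp (f : clin A B) : clin A B := 
  CLin (clin_opp_linear f) (@clin_opp_continuous A B f).
Definition clin_add (f g : clin A B) : clin A B :=
  CLin (clin_add_linear f g) (@clin_add_continuous A B f g).

Lemma clin_addA : associative clin_add.
Proof. by move=> f g h; apply: clinP => x /=; rewrite addrA. Qed.
Lemma clin_addC : commutative clin_add.
Proof. by move=> f g; apply: clinP => x /=; rewrite addrC. Qed.
Lemma clin_add0 : left_id clin_zero clin_add.
Proof. by move=> f; apply: clinP => x /=; rewrite add0r. Qed.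
Lemma clin_addN : left_inverse clin_zero clin_opp clin_add.
Proof. by move=> f; apply: clinP => x /=; rewrite addNr. Qed.

HB.instance Definition _ := GRing.isZmodule.Build (clin A B)
  clin_addA clin_addC clin_add0 clin_addN.

Lemma clin0E x : (0 : clin A B) x = 0. Proof. by []. Qed.
Lemma clinDE (f g : clin A B) x : (f + g) x = f x + g x. Proof. by []. Qed.

End Clin.

Infix "\oc" := clin_comp (at level 40, left associativity).

Section Category.
Context (k : fieldType).
Local Notation TopS := (sepLinTopType k).

(* Kernels and cokernels are taken in the category of separated spaces. *)
Definition is_kernel (K A B : TopS) (i : clin K A) (f : clin A B) : Prop :=
  f \oc i = 0 /\
  forall (X : TopS) (g : clin X A), f \oc g = 0 ->
    exists! h : clin X K, i \oc h = g.

Definition is_cokernel (A B C : TopS) (p : clin B C) (f : clin A B) : Prop :=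
  p \oc f = 0 /\
  forall (X : TopS) (g : clin B X), g \oc f = 0 ->
    exists! h : clin C X, h \oc p = g.

(* The short exact sequences of the quasi-abelian exact structure. *)
Definition short_exact (A' A A'' : TopS) (i : clin A' A) (p : clin A A'') :
  Prop := is_kernel i p /\ is_cokernel p i.

Record endofunctor := Endofunctor {
  fobj :> TopS -> TopS;
  fmap : forall A B : TopS, clin A B -> clin (fobj A) (fobj B);
  fmap_id : forall A : TopS, fmap (clin_id A) = clin_id (fobj A);
  fmap_comp : forall (A B C : TopS) (g : clin B C) (f : clin A B),
    fmap (g \oc f) = fmap g \oc fmap f
}.

Record bifunctor := Bifunctor {
  bobj :> TopS -> TopS -> TopS;
  bmap : forall A A' B B' : TopS, clin A A' -> clin B B' ->
    clin (bobj A B) (bobj A' B');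
  bmap_id : forall A B : TopS, bmap (clin_id A) (clin_id B) = clin_id (bobj A B);
  bmap_comp : forall (A A' A'' B B' B'' : TopS)
      (f' : clin A' A'') (f : clin A A') (g' : clin B' B'') (g : clin B B'),
    bmap (f' \oc f) (g' \oc g) = bmap f' g' \oc bmap f g
}.

Lemma clin_comp_id (A : TopS) : clin_id A \oc clin_id A = clin_id A.
Proof. exact: clinP. Qed.

Definition fix_left (T : bifunctor) (U : TopS) : endofunctor.
Proof.
refine (@Endofunctor (T U) (fun A B f => bmap T (clin_id U) f) _ _).
- by move=> A; exact: bmap_id.
- by move=> A B C g f; rewrite -bmap_comp clin_comp_id.
Defined.

Definition fix_right (T : bifunctor) (V : TopS) : endofunctor.
Proof.
refine (@Endofunctor (T^~ V) (fun A B f => bmap T f (clin_id V)) _ _).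
- by move=> A; exact: bmap_id.
- by move=> A B C g f; rewrite -bmap_comp clin_comp_id.
Defined.

Definition preserves_kernels (F : endofunctor) : Prop :=
  forall (K A B : TopS) (i : clin K A) (f : clin A B),
    is_kernel i f -> is_kernel (fmap F i) (fmap F f).

Definition preserves_cokernels (F : endofunctor) : Prop :=
  forall (A B C : TopS) (p : clin B C) (f : clin A B),
    is_cokernel p f -> is_cokernel (fmap F p) (fmap F f).

Definition additive_functor (F : endofunctor) : Prop :=
  forall (A B : TopS) (f g : clin A B), fmap F (f + g) = fmap F f + fmap F g.

Definition exact_functor (F : endofunctor) : Prop :=
  additive_functor F /\
  forall (A' A A'' : TopS) (i : clin A' A) (p : clin A A''),
    short_exact i p -> short_exact (fmap F i) (fmap F p).

Definition in_each_argument (P : endofunctor -> Prop) (T : bifunctor) : Prop :=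
  (forall U : TopS, P (fix_left T U)) /\ (forall V : TopS, P (fix_right T V)).

End Category.

Section TensorFunctors.
Context (k : fieldType).
Local Notation TopS := (sepLinTopType k).

Lemma tensor_map_id (A B : TopS) : @tensor_map k A A B B idfun idfun =1 idfun.
Proof.
by apply: (tensor_linear_ext (g := idfun)) => u v; exact: tensor_mapE.
Qed.

Lemma tensor_map_comp (A A' A'' B B' B'' : TopS)
    (f' : clin A' A'') (f : clin A A') (g' : clin B' B'') (g : clin B B') :
  tensor_map (f' \oc f) (g' \oc g) =1 tensor_map f' g' \o tensor_map f g.
Proof.
apply: (tensor_linear_ext (g := tensor_map f' g' \o tensor_map f g)) => u v.
by rewrite /= !tensor_mapE.
Qed.

Section Maps.
Context (A A' B B' : TopS) (f : clin A A') (g : clin B B').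

Definition star_linear : {linear star_space A B -> star_space A' B'} :=
  tensor_map f g : {linear tensor A B -> tensor A' B'}.
Definition larrow_linear : {linear larrow_space A B -> larrow_space A' B'} :=
  tensor_map f g : {linear tensor A B -> tensor A' B'}.
Definition shriek_linear : {linear shriek_space A B -> shriek_space A' B'} :=
  tensor_map f g : {linear tensor A B -> tensor A' B'}.

Lemma star_continuous : continuous star_linear.
Proof.
apply/linear_continuousP => E.
move=> /topologized_open_subspace/star_openE[sE [P [Q [oP oQ PQ]]] hu hv].
apply/topologized_open_subspace/star_openE.
split; first exact: (@lsubspace_preimage _ _ _ (tensor_map f g)).
- exists (f @^-1` P), (g @^-1` Q); split; [exact: clin_open_preimage..|].
  by move=> u v Pu Qv; rewrite /preimage/= tensor_mapE; exact: PQ.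
- move=> u; have [R oR RE] := hu (f u).
  exists (g @^-1` R); first exact: clin_open_preimage.
  by move=> v Rv; rewrite /preimage/= tensor_mapE; exact: RE.
- move=> v; have [R oR RE] := hv (g v).
  exists (f @^-1` R); first exact: clin_open_preimage.
  by move=> u Ru; rewrite /preimage/= tensor_mapE; exact: RE.
Qed.

Lemma larrow_continuous : continuous larrow_linear.
Proof.
apply/linear_continuousP => E.
move=> /topologized_open_subspace/larrow_openE[sE [P oP PE] hu].
apply/topologized_open_subspace/larrow_openE.
split; first exact: (@lsubspace_preimage _ _ _ (tensor_map f g)).
- exists (f @^-1` P); first exact: clin_open_preimage.
  by move=> u v Pu; rewrite /preimage/= tensor_mapE; exact: PE.
- move=> u; have [R oR RE] := hu (f u).
  exists (g @^-1` R); first exact: clin_open_preimage.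
  by move=> v Rv; rewrite /preimage/= tensor_mapE; exact: RE.
Qed.

Lemma shriek_continuous : continuous shriek_linear.
Proof.
apply/linear_continuousP => E.
move=> /topologized_open_subspace/shriek_openE[sE [P [Q [oP oQ PE QE]]]].
apply/topologized_open_subspace/shriek_openE.
split; first exact: (@lsubspace_preimage _ _ _ (tensor_map f g)).
exists (f @^-1` P), (g @^-1` Q); split; [exact: clin_open_preimage..| |].
  by move=> u v Pu; rewrite /preimage/= tensor_mapE; exact: PE.
by move=> u v Qv; rewrite /preimage/= tensor_mapE; exact: QE.
Qed.

End Maps.

Definition tensor_star : bifunctor k.
Proof.
refine (@Bifunctor k (@star_space k)
  (fun A A' B B' f g =>
    @CLin k (star_space A B) (star_space A' B') (tensor_map f g)
      (@tensor_map_linear k A A' B B' f g) (@star_continuous A A' B B' f g)) _ _).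
- by move=> A B; apply: clinP; exact: tensor_map_id.
- by move=> A A' A'' B B' B'' f' f g' g; apply: clinP; exact: tensor_map_comp.
Defined.

Definition tensor_larrow : bifunctor k.
Proof.
refine (@Bifunctor k (@larrow_space k)
  (fun A A' B B' f g =>
    @CLin k (larrow_space A B) (larrow_space A' B') (tensor_map f g)
      (@tensor_map_linear k A A' B B' f g) (@larrow_continuous A A' B B' f g)) _ _).
- by move=> A B; apply: clinP; exact: tensor_map_id.
- by move=> A A' A'' B B' B'' f' f g' g; apply: clinP; exact: tensor_map_comp.
Defined.

Definition tensor_shriek : bifunctor k.
Proof.
refine (@Bifunctor k (@shriek_space k)
  (fun A A' B B' f g =>
    @CLin k (shriek_space A B) (shriek_space A' B') (tensor_map f g)
      (@tensor_map_linear k A A' B B' f g) (@shriek_continuous A A' B B' f g)) _ _).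
- by move=> A B; apply: clinP; exact: tensor_map_id.
- by move=> A A' A'' B B' B'' f' f g' g; apply: clinP; exact: tensor_map_comp.
Defined.

End TensorFunctors.

(* Main.v *)
From HB Require Import structures.
From mathcomp Require Import all_boot all_algebra.
From mathcomp Require Import boolp classical_sets functions topology.
Require Import Defs.

Set Implicit Arguments.
Unset Strict Implicit.
Unset Printing Implicit Defensive.

Import GRing.Theory.

Local Open Scope classical_set_scope.
Local Open Scope ring_scope.

(** Why the theorem is true.

    Kernels and cokernels are first made concrete ([kernelP], [cokernelP]):
    [i] is a kernel of [f] iff it is an algebraic kernel and its source has the
    induced topology; [p] is a cokernel of [f] iff it is onto, has the quotient
    topology, and every open subspace containing the image of [f] contains the
    algebraic kernel of [p], i.e. this kernel is the closure of the image.
    Both properties of a tensored map then split into algebra and topology.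

    Algebra. Every linear map [f] over a field has a generalized inverse [s],
    with [f s f = f]. Tensoring generalized inverses shows that injectivity and
    surjectivity survive, and that the kernel of a tensor product of maps is
    spanned by the tensors with a factor in the corresponding kernel
    ([tensor_map_ker]).

    Cokernels. For fixed [u] the vectors [b] such that the tensor of [u] and [b]
    lies in a given open subspace form an open subspace of [B], for each of the
    three topologies; this gives the closure condition on pure tensors, which
    suffices by [tensor_map_ker]. The quotient topology is preserved because a
    cokernel is an open map, so that neighbourhoods in the definitions of the
    topologies can be pushed forward.

    Kernels. The point is that an open subspace [E] of the tensor product of [U]
    and [K] is the trace of an open subspace of the tensor product of [U] and
    [A], when [K] is embedded in [A] by [i]. For a single open subspace [Q] of
    [K] there is a linear retraction of [i] which carries some open [R] into [Q]
    ([topological_embedding_retraction]). For [!], and for the first argument of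
    the arrow product, pulling [E] back along one tensored retraction is enough.
    In the remaining cases [E] prescribes an open subspace [Q_u] for every [u],
    without uniformity, and no single retraction fits all of them. One chooses a
    retraction for each vector of a spanning set of [U], taking the same one for
    all the vectors of the open subspace [P] that occurs in the openness of [E],
    and assembles these into a retraction of the tensor products that is not
    itself a tensor product of maps ([slicewise_retraction]); since each [u] is
    a finite combination of the spanning vectors, finite intersections of open
    subspaces give openness.

    The star and [!] products are symmetric, so that it is enough to fix their
    first argument. Exactness is additivity together with the preservation of
    kernels and cokernels. *)

(** * Linear algebra over a field *)

Section LinearAlgebra.
Context (k : fieldType).
Implicit Types U V M K A : lmodType k.

Lemma exists_linear U V (f : U -> V) :
  linear f -> exists L : {linear U -> V}, L =1 f.
Proof.
move=> lf; pose m := GRing.isLinear.Build k U V _ f lf.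
by exists (HB.pack f m : {linear U -> V}).
Qed.

Lemma sub_lspan U (S : set U) : S `<=` smallest lsubspace S.
Proof. exact: sub_gen_smallest. Qed.

Lemma lspan_ind U (S E : set U) : lsubspace E -> S `<=` E ->
  forall x, smallest lsubspace S x -> E x.
Proof. by move=> sE SE; exact: smallest_sub. Qed.

Lemma lspanS U (S S' : set U) :
  S `<=` S' -> smallest lsubspace S `<=` smallest lsubspace S'.
Proof.
move=> SS'; apply: lspan_ind; first exact: smallest_lsubspace.
by apply: subset_trans SS' _; exact: sub_lspan.
Qed.

Lemma lsubspace_image U V (f : {linear U -> V}) (E : set U) :
  lsubspace E -> lsubspace (f @` E).
Proof.
move=> [E0 hE]; split; first by exists 0 => //; exact: linear0.
by move=> a _ _ [x Ex <-] [y Ey <-]; exists (a *: x + y);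
  [exact: hE|rewrite linearP].
Qed.

(** Linear relations, given by their graphs, serve as partially defined linear
    maps: a subspace of the product which is functional above zero is the graph
    of a linear map on its domain. *)
Definition graph_functional U M (G : set (U * M)) :=
  forall m, G (0, m) -> m = 0.

Lemma graph_functionalP U M (G : set (U * M)) u m m' :
  lsubspace G -> graph_functional G -> G (u, m) -> G (u, m') -> m = m'.
Proof.
move=> sG fG Gm Gm'; apply/eqP; rewrite -subr_eq0; apply/eqP; apply: fG.
suff -> : (0, m - m') = (u, m) - (u, m') by exact: lsubspaceB.
by apply: injective_projections; rewrite /= ?subrr.
Qed.

(** The use of a Hamel basis, without bases: Zorn's lemma gives a maximal set of
    points of the graph of [val] whose span with [G] is still functional. If some
    [u] were outside the domain of that span, [(u, val u)] could be added. The
    conclusion records that the values prescribed by [G] and those prescribed by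
    [val] determine [L], so that properties of [L] stable under linear
    combinations can be checked on them. *)
Lemma linear_extension_prescribed U M (G : set (U * M)) (val : U -> M) :
  lsubspace G -> graph_functional G ->
  exists2 L : {linear U -> M}, (forall u m, G (u, m) -> L u = m) &
    forall u, smallest lsubspace
      ([set u | exists m, G (u, m)] `|` [set b | L b = val b]) u.
Proof.
move=> sG fG.
pose D (S : set (U * M)) := smallest lsubspace (G `|` S).
have sD S : lsubspace (D S) by exact: smallest_lsubspace.
have D0 x : D set0 x -> G x by apply: lspan_ind => // y [].
have DS S S' : S `<=` S' -> D S `<=` D S'.
  by move=> SS'; apply: lspanS => x [Gx|/SS' ?]; [left|right].
pose P (S : set (U * M)) :=
  S `<=` [set p | p.2 = val p.1] /\ graph_functional (D S).
have [F FP totF|S [[Sval fS] maxS]] := @Zorn_bigcup _ P.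
  split=> [x [S /FP[Sval _]] /Sval//|m].
  (* The empty set is added to the chain so that the union of the spans is
     a subspace even when the chain is empty. *)
  pose F' := [set S | S = set0 \/ F S].
  suff /[apply] -[S [->|/FP[_ fS]]] : forall x, D (\bigcup_(S in F) S) x ->
      exists2 S, F' S & D S x.
  - by move/D0; exact: fG.
  - exact: fS.
  apply: lspan_ind => [|x [Gx|[S FS Sx]]]; last 2 first.
  - by exists set0; [left|apply: sub_lspan; left].
  - by exists S; [right|apply: sub_lspan; right].
  split; first by exists set0; [left|case: (sD set0)].
  have totF' S S' : F' S -> F' S' -> S `<=` S' \/ S' `<=` S.
    by move=> [->|FS] [->|FS']; [left|left|right|exact: totF].
  move=> a x y [S FS Sx] [S' FS' Sy].
  have [SS'|SS'] := totF' _ _ FS FS'.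
    by exists S' => //; apply: (sD S').2 => //; exact: DS Sx.
  by exists S => //; apply: (sD S).2 => //; exact: DS Sy.
have dom u : exists m, D S (u, m).
  apply: contrapT => nu.
  have nSu : ~ S (u, val u).
    by move=> Su; apply: nu; exists (val u); apply: sub_lspan; right.
  (* A multiple [c (u, val u)] with [c] nonzero cannot lie over zero modulo
     [D S], since then [u] would be in the domain of [D S]. *)
  apply: (maxS (S `|` [set (u, val u)])).
    by split=> [|/(_ (u, val u)) h]; [left|apply: nSu; apply: h; right].
  split=> [x [/Sval//|->//]|m].
  have : forall x, D (S `|` [set (u, val u)]) x ->
      exists2 c : k, True & D S (x - c *: (u, val u)).
    apply: lspan_ind => [|x [Gx|[Sx|->]]].
    - split; first by exists 0 => //; rewrite scale0r subr0; case: (sD S).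
      move=> a x y [c _ cx] [d _ dy]; exists (a * c + d) => //.
      by rewrite scalerDl opprD addrACA -scalerA -scalerBr; exact: (sD S).2.
    - by exists 0 => //; rewrite scale0r subr0; apply: sub_lspan; left.
    - by exists 0 => //; rewrite scale0r subr0; apply: sub_lspan; right.
    - by exists 1 => //; rewrite scale1r subrr; case: (sD S).
  move=> /[apply] -[c _].
  have [->|c0] := eqVneq c 0; first by rewrite scale0r subr0; exact: fS.
  move=> h; case: nu; exists (- c^-1 *: (m - c *: val u)).
  suff -> : (u, - c^-1 *: (m - c *: val u)) =
      - c^-1 *: ((0, m) - c *: (u, val u)) by exact: (lsubspaceZ _ (sD S) h).
  apply: injective_projections => //=.
  by rewrite sub0r scalerN scaleNr opprK scalerA mulVf// scale1r.
pose L0 u := projT1 (cid (dom u)).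
have L0P u : D S (u, L0 u) by exact: projT2 (cid (dom u)).
have L0E u m : D S (u, m) -> L0 u = m.
  by move=> Dm; exact: graph_functionalP (sD S) fS (L0P u) Dm.
have [L LE] : exists L : {linear U -> M}, L =1 L0.
  apply: exists_linear => a x y; apply: L0E.
  exact: (sD S).2 a _ _ (L0P x) (L0P y).
exists L => [u m Gm|u]; first by rewrite LE; apply: L0E; apply: sub_lspan; left.
have : forall x, D S x -> smallest lsubspace
    ([set u | exists m, G (u, m)] `|` [set b | L b = val b]) x.1.
  apply: lspan_ind => [|[v m] [Gm|Sv]].
  - exact: (lsubspace_preimage (fst : {linear (U * M)%type -> U})
      (smallest_lsubspace _)).
  - by apply: sub_lspan; left; exists m.
  - apply: sub_lspan; right; rewrite /= LE; apply: L0E; apply: sub_lspan; right.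
    by rewrite -(Sval _ Sv).
by move=> /(_ _ (L0P u)).
Qed.

(** Prescribing the identity on [P] and zero elsewhere gives a map that takes
    all its values in [P], because it does so on a spanning set. *)
Lemma exists_linear_projection U (P : set U) : lsubspace P ->
  exists2 e : {linear U -> U}, (forall x, P x -> e x = x) & forall x, P (e x).
Proof.
move=> sP; pose G := [set p : U * U | P p.1 /\ p.2 = p.1].
have [||e eP span] := @linear_extension_prescribed U U G (fun=> 0).
- split=> [|a x y /= [Px xE] [Py yE]].
    by split=> //; case: sP.
  by split; [exact: sP.2|rewrite /= xE yE].
- by move=> m [_].
exists e => [x Px|x]; first exact: eP.
apply: (lspan_ind (E := e @^-1` P) _ _ (span x)) => [|y [[m /[dup] Gm [Px _]]|]].
- exact: lsubspace_preimage.
- by rewrite /preimage/= (eP _ _ Gm); case: Gm => _ /= ->.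
- by rewrite /preimage/= => ->; case: sP.
Qed.

(** With [e] a projection onto the kernel of [f], the element [x - e x] depends
    only on [f x]; the map sending [f x] to it extends to all of [V]. *)
Lemma generalized_inverse U V (f : {linear U -> V}) :
  exists s : {linear V -> U}, forall x, f (s (f x)) = f x.
Proof.
have sK : lsubspace [set x | f x = 0].
  split=> [|a x y /= x0 y0]; first exact: linear0.
  by rewrite linearP x0 y0 scaler0 addr0.
have [e eK Ke] := exists_linear_projection sK.
pose G := [set p : V * U | exists x, p = (f x, x - e x)].
have [||s sG _] := @linear_extension_prescribed V U G (fun=> 0).
- split=> [|a _ _ [x ->] [y ->]].
    by exists 0; rewrite (linear0 f) (linear0 e) subr0.
  exists (a *: x + y); apply: injective_projections; rewrite /= linearP //.
  by rewrite opprD addrACA -scalerBr.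
- by move=> m [x [/esym fx ->]]; rewrite (eK x) ?subrr.
exists s => x; rewrite (sG (f x) (x - e x)); last by exists x.
by rewrite linearB (Ke x) subr0.
Qed.

Lemma linear_left_inverse U V (f : {linear U -> V}) :
  injective f -> exists s : {linear V -> U}, cancel f s.
Proof.
by move=> injf; have [s fs] := generalized_inverse f; exists s => x; exact: injf.
Qed.

Lemma linear_right_inverse U V (f : {linear U -> V}) :
  (forall y, exists x, f x = y) -> exists s : {linear V -> U}, cancel s f.
Proof.
move=> surjf; have [s fs] := generalized_inverse f; exists s => y.
by have [x <-] := surjf y.
Qed.

(** Let [e] be a projection onto [R] and [j = (1 - e) i], whose kernel is the
    preimage of [R]. If [s] is a generalized inverse of [j] and [tau] any
    retraction of [i], then [rho = s (1 - e) + (1 - s j) tau] is a retraction,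
    and on [R] only the second summand survives, which lies in the kernel
    of [j]. *)
Lemma linear_retraction_adapted K A (i : {linear K -> A}) (R : set A) :
  injective i -> lsubspace R ->
  exists2 rho : {linear A -> K}, cancel i rho & forall a, R a -> R (i (rho a)).
Proof.
move=> injf sR.
have [e eR Re] := exists_linear_projection sR.
have [tau itau] := linear_left_inverse injf.
pose j : {linear K -> A} := (idfun \- e) \o i.
have jE x : j x = i x - e (i x) by [].
have [s js] := generalized_inverse j.
pose rho : {linear A -> K} :=
  (s \o (idfun \- e)) \+ ((idfun \- (s \o j)) \o tau).
have rhoE a : rho a = s (a - e a) + (tau a - s (j (tau a))) by [].
exists rho => [x|a Ra].
  by rewrite rhoE -jE itau addrC subrK.
rewrite rhoE eR// subrr linear0 add0r.
(* [j] kills this element, so its image is fixed by the projection [e]. *)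
have : j (tau a - s (j (tau a))) = 0 by rewrite linearB js subrr.
by rewrite jE => /eqP; rewrite subr_eq0 => /eqP ->; exact: Re.
Qed.

End LinearAlgebra.

(** * Tensor products of linear maps *)

Section TensorAlgebra.
Context (k : fieldType).
Implicit Types U V W : lmodType k.

Lemma tensor_map_comp_lin U U' U'' V V' V'' (f' : {linear U' -> U''})
    (f : {linear U -> U'}) (g' : {linear V' -> V''}) (g : {linear V -> V'}) t :
  tensor_map f' g' (tensor_map f g t) = tensor_map (f' \o f) (g' \o g) t.
Proof.
apply: (tensor_linear_ext (f := tensor_map f' g' \o tensor_map f g)
  (g := tensor_map (f' \o f) (g' \o g))) => u v.
by rewrite /= !tensor_mapE.
Qed.

Lemma eq_tensor_map U U' V V' (f f' : {linear U -> U'})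
    (g g' : {linear V -> V'}) :
  f =1 f' -> g =1 g' -> tensor_map f g =1 tensor_map f' g'.
Proof.
move=> ff' gg'; apply: tensor_linear_ext => u v.
by rewrite /= !tensor_mapE ff' gg'.
Qed.

Lemma tensor_map_idfun U V t : @tensor_map k U U V V idfun idfun t = t.
Proof.
apply: (tensor_linear_ext (f := tensor_map idfun idfun) (g := idfun)) => u v.
exact: tensor_mapE.
Qed.

Lemma tensor_map_cancel U U' V V' (f : {linear U -> U'}) (f' : {linear U' -> U})
    (g : {linear V -> V'}) (g' : {linear V' -> V}) :
  cancel f f' -> cancel g g' -> cancel (tensor_map f g) (tensor_map f' g').
Proof.
move=> ff' gg' t; rewrite tensor_map_comp_lin -[RHS]tensor_map_idfun.
exact: eq_tensor_map.
Qed.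

Lemma tensor_map_inj U U' V V' (f : {linear U -> U'}) (g : {linear V -> V'}) :
  injective f -> injective g -> injective (tensor_map f g).
Proof.
move=> /linear_left_inverse[f' ff'] /linear_left_inverse[g' gg'].
exact: can_inj (tensor_map_cancel ff' gg').
Qed.

Lemma tensor_map_surj U U' V V' (f : {linear U -> U'}) (g : {linear V -> V'}) :
  (forall y, exists x, f x = y) -> (forall y, exists x, g x = y) ->
  forall t, exists s, tensor_map f g s = t.
Proof.
move=> /linear_right_inverse[f' ff'] /linear_right_inverse[g' gg'] t.
by exists (tensor_map f' g' t); exact: tensor_map_cancel.
Qed.

(** With [f'] and [g'] generalized inverses, a tensor killed by the product of
    [f] and [g] is equal to its difference with its image under the product of
    [f' f] and [g' g]; on pure tensors this difference is a sum of two pure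
    tensors, one with a factor killed by [f], one with a factor killed
    by [g]. *)
Lemma tensor_map_ker U U' V V' (f : {linear U -> U'}) (g : {linear V -> V'})
    (E : set (tensor U V)) : lsubspace E ->
  (forall u v, f u = 0 -> E (u \ox v)) -> (forall u v, g v = 0 -> E (u \ox v)) ->
  forall t, tensor_map f g t = 0 -> E t.
Proof.
move=> sE fE gE t t0.
have [f' ff'] := generalized_inverse f; have [g' gg'] := generalized_inverse g.
pose h := tensor_map (f' \o f) (g' \o g).
have h0 : h t = 0 by rewrite /h -tensor_map_comp_lin t0 linear0.
rewrite -[t]subr0 -h0.
have : lsubspace [set t | E (t - h t)].
  exact: (lsubspace_preimage (idfun \- h : {linear _ -> _}) sE).
move=> /tensor_ind; apply => u v; rewrite /= /h tensor_mapE /=.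
have -> : u \ox v - f' (f u) \ox g' (g v) =
    (u - f' (f u)) \ox v + f' (f u) \ox (v - g' (g v)).
  by rewrite tmulDl -scaleN1r tmulZl scaleN1r raddfB /= addrA subrK.
apply: lsubspaceD => //.
  by apply: fE; rewrite linearB ff' subrr.
by apply: gE; rewrite linearB gg' subrr.
Qed.

Lemma tensor_map_exact U U' U'' V V' V'' (f : {linear U -> U'})
    (f' : {linear U'' -> U}) (g : {linear V -> V'}) (g' : {linear V'' -> V}) :
  (forall u v, f u = 0 \/ g v = 0 -> exists s, tensor_map f' g' s = u \ox v) ->
  forall t, tensor_map f g t = 0 -> exists s, tensor_map f' g' s = t.
Proof.
move=> h t t0.
have sE : lsubspace (range (tensor_map f' g')).
  exact: lsubspace_image (@lsubspaceT _ _).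
have [u v fu|u v gv|s _ <-] := tensor_map_ker sE _ _ t0; last by exists s.
- by have [s <-] := h u v (or_introl fu); exists s.
- by have [s <-] := h u v (or_intror gv); exists s.
Qed.

Lemma tensor_map_comp0 U U' U'' V V' V'' (f : {linear U' -> U''})
    (f' : {linear U -> U'}) (g : {linear V' -> V''}) (g' : {linear V -> V'}) :
  (forall u v, f (f' u) \ox g (g' v) = 0) ->
  forall t, tensor_map f g (tensor_map f' g' t) = 0.
Proof.
move=> h t; rewrite tensor_map_comp_lin.
apply: (tensor_linear_ext (f := tensor_map (f \o f') (g \o g')) (g := \0)).
by move=> u v; rewrite /= tensor_mapE; exact: h.
Qed.

Lemma tensor_mapDl U U' V V' (f f' h : {linear U -> U'})
    (g : {linear V -> V'}) : (forall u, h u = f u + f' u) ->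
  forall t, tensor_map h g t = tensor_map f g t + tensor_map f' g t.
Proof.
move=> hE; apply: (tensor_linear_ext (f := tensor_map h g)
  (g := tensor_map f g \+ tensor_map f' g)) => u v.
by rewrite /= !tensor_mapE hE tmulDl.
Qed.

Lemma tensor_mapDr U U' V V' (f : {linear U -> U'})
    (g g' h : {linear V -> V'}) : (forall v, h v = g v + g' v) ->
  forall t, tensor_map f h t = tensor_map f g t + tensor_map f g' t.
Proof.
move=> hE; apply: (tensor_linear_ext (f := tensor_map f h)
  (g := tensor_map f g \+ tensor_map f g')) => u v.
by rewrite /= !tensor_mapE hE linearD.
Qed.

Lemma exists_tensor_lift U V W (b : U -> V -> W) :
  (forall v, linear (b^~ v)) -> (forall u, linear (b u)) ->
  exists L : {linear tensor U V -> W}, forall u v, L (u \ox v) = b u v.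
Proof.
move=> bl br; have [L LE] := exists_linear (tensor_lift_linear bl br).
by exists L => u v; rewrite LE tensor_liftE.
Qed.

Definition tensor_swap U V : tensor U V -> tensor V U :=
  tensor_lift (fun u v => v \ox u).

Lemma tensor_swap_linear U V : linear (@tensor_swap U V).
Proof.
apply: tensor_lift_linear => [v|u]; first exact: linearP.
exact: tmul_linearl.
Qed.

HB.instance Definition _ U V := GRing.isLinear.Build k (tensor U V) (tensor V U)
  _ (@tensor_swap U V) (@tensor_swap_linear U V).

Lemma tensor_swapE U V (u : U) (v : V) : tensor_swap (u \ox v) = v \ox u.
Proof.
by apply: tensor_liftE => [w|w]; [exact: linearP|exact: tmul_linearl].
Qed.

Lemma tensor_swapK U V : cancel (@tensor_swap U V) (@tensor_swap V U).
Proof.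
apply: (tensor_linear_ext (f := @tensor_swap V U \o @tensor_swap U V)
  (g := idfun)) => u v.
by rewrite /= !tensor_swapE.
Qed.

Lemma tensor_swap_map U U' V V' (f : {linear U -> U'}) (g : {linear V -> V'}) t :
  tensor_swap (tensor_map f g t) = tensor_map g f (tensor_swap t).
Proof.
apply: (tensor_linear_ext (f := @tensor_swap U' V' \o tensor_map f g)
  (g := tensor_map g f \o @tensor_swap U V)) => u v.
by rewrite /= !(tensor_mapE, tensor_swapE).
Qed.

End TensorAlgebra.

(** * Kernels and cokernels of separated linear topologies *)

Section LinearTopologies.
Context (k : fieldType).

Lemma open_subspaceS (V : linTopType k) (E F : set V) :
  open_subspace E -> lsubspace F -> E `<=` F -> open_subspace F.
Proof.
move=> oE sF EF; split=> //; rewrite openE => x Fx.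
by apply/open_subspace_nbhs; exists E => // e /EF Fe; exact: lsubspaceD.
Qed.

Lemma clin_eq1 (A B : linTopType k) (f g : clin A B) : f = g -> f =1 g.
Proof. by move=> ->. Qed.

Lemma exists_clin (A B : linTopType k) (f : A -> B) : linear f ->
  (forall E, open_subspace E -> open_subspace (f @^-1` E)) ->
  exists g : clin A B, g =1 f.
Proof.
move=> lf of_; have [L LE] := exists_linear lf.
have cL : continuous L.
  by apply/linear_continuousP => E /of_; rewrite (funext LE).
by exists (CLin (fun a x y => linearP L a x y) cL).
Qed.

(** The discrete line is a test object twice over: maps from it are vectors, and
    maps to it are linear functionals with open kernel. *)
Definition discrete_filter (W : lmodType k) : sepFilter W.
Proof.
refine (@SepFilter k W lsubspace (fun _ h => h) _ _ _ _).
- exact: lsubspaceT.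
- exact: lsubspaceI.
- by [].
- move=> x /(_ [set 0]); apply; split=> // a y z /= -> ->.
  by rewrite scaler0 addr0.
Defined.

Definition discrete_line : sepLinTopType k := topologized (discrete_filter k^o).

Lemma exists_clin_point (A : linTopType k) (a : A) :
  exists g : clin discrete_line A, forall c : k, g c = c *: a.
Proof.
have lf : linear (fun c : k^o => (c : k) *: a).
  by move=> b c d; rewrite scalerDl -scalerA.
apply: exists_clin => // E [_ sE]; apply/topologized_open_subspace.
have [L LE] := exists_linear lf.
by rewrite -(funext LE); exact: lsubspace_preimage.
Qed.

Lemma exists_clin_functional (A : linTopType k) (E : set A) (a : A) :
  open_subspace E -> ~ E a ->
  exists2 phi : clin A discrete_line, (forall x, E x -> phi x = 0) & phi a != 0.
Proof.
move=> oE nEa; have [phi phiE phia] := lsubspace_functional oE.2 nEa.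
have [||g gE] := @exists_clin A discrete_line phi.
- by move=> c x y; exact: linearP.
- move=> F /topologized_open_subspace sF; apply: open_subspaceS oE _ _.
    exact: (@lsubspace_preimage _ _ _ phi).
  by move=> x /phiE; rewrite /preimage /= => ->; case: sF.
exists g => [x /phiE|]; first by rewrite gE.
by rewrite gE phia oner_eq0.
Qed.

Definition topological_embedding (K A : linTopType k) (i : K -> A) :=
  forall E : set K, open_subspace E ->
    exists2 F : set A, open_subspace F & i @^-1` F `<=` E.

Definition topological_quotient (B C : linTopType k) (p : B -> C) :=
  forall E : set C, lsubspace E -> open_subspace (p @^-1` E) -> open_subspace E.

(** A retraction of a topological embedding need not be continuous, but it can be
    chosen continuous with respect to one prescribed open subspace. *)
Lemma topological_embedding_retraction (K A : linTopType k)
    (i : {linear K -> A}) (Q : set K) :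
  injective i -> topological_embedding i -> open_subspace Q ->
  exists2 rho : {linear A -> K}, cancel i rho &
    exists2 R : set A, open_subspace R & forall a, R a -> Q (rho a).
Proof.
move=> inji embi /embi[R oR RQ].
have [rho irho Rrho] := linear_retraction_adapted inji oR.2.
by exists rho => //; exists R => // a /Rrho /RQ.
Qed.

Lemma topological_quotient_image (B C : linTopType k) (p : {linear B -> C})
    (P : set B) :
  topological_quotient p -> open_subspace P -> open_subspace (p @` P).
Proof.
move=> quop oP.
have spP : lsubspace (p @` P) by exact: lsubspace_image oP.2.
apply: quop => //; apply: open_subspaceS oP _ _.
  exact: lsubspace_preimage.
by move=> b Pb; exists b.
Qed.

End LinearTopologies.

Section KernelsCokernels.
Context (k : fieldType).
Local Notation TopS := (sepLinTopType k).
Implicit Types A B C K X : TopS.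

(** Maps from the discrete line give injectivity and exactness. For the topology
    the test object is [K] with the topology induced by [i]: the lift of [i]
    through [i] can only be the identity, whose continuity says that the induced
    topology is the given one. *)
Lemma kernelP K A B (i : clin K A) (f : clin A B) : is_kernel i f <->
  [/\ forall x, f (i x) = 0, injective i,
      forall a, f a = 0 -> exists x, i x = a & topological_embedding i].
Proof.
split=> [[/clin_eq1 fi0 uniK]|].
  have inji : injective i.
    move=> x y ixy; have [gx gxE] := exists_clin_point x.
    have [gy gyE] := exists_clin_point y.
    have fgx0 : f \oc (i \oc gx) = 0.
      by apply: clinP => c; exact: (fi0 (gx c)).
    have [h [_ hu]] := uniK _ _ fgx0.
    have gxy : gx = gy.
      rewrite -(hu gx erefl); apply: hu; apply: clinP => c.
      by rewrite /= gxE gyE !linearZ_LR /= ixy.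
    by rewrite -[x]scale1r -[y]scale1r -gxE -gyE gxy.
  split=> //.
  - move=> a fa0; have [g gE] := exists_clin_point a.
    have fg0 : f \oc g = 0.
      by apply: clinP => c; rewrite /= gE linearZ_LR /= fa0 scaler0.
    have [h [ih _]] := uniK _ _ fg0; exists (h (1 : k)).
    by have := clin_eq1 ih (1 : k); rewrite /= gE scale1r.
  pose ind (E : set K) := lsubspace E /\
    exists2 F : set A, open_subspace F & i @^-1` F `<=` E.
  have indS E : ind E -> lsubspace E by case.
  have indT : ind setT.
    by split; [exact: lsubspaceT|exists setT => //; exact: (open_subspaceT A)].
  have indI E E' : ind E -> ind E' -> ind (E `&` E').
    move=> [sE [F oF FE]] [sE' [F' oF' FE']].
    split; first exact: lsubspaceI.
    exists (F `&` F'); first exact: open_subspaceI.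
    by move=> x [/FE ? /FE' ?].
  have indU E E' : ind E -> lsubspace E' -> E `<=` E' -> ind E'.
    move=> [_ [F oF FE]] sE' EE'; split=> //; exists F => //.
    exact: subset_trans EE'.
  have ind_sep x : (forall E, ind E -> E x) -> x = 0.
    move=> indx; apply: inji; rewrite linear0; apply: separated0 => E oE sE.
    apply: (indx (i @^-1` E)); split; first exact: lsubspace_preimage.
    by exists E.
  pose X : TopS := topologized (SepFilter indS indT indI indU ind_sep).
  have [|E oE|g gE] := @exists_clin k X A i.
  - by move=> a x y; exact: linearP.
  - apply/topologized_open_subspace; split; last by exists E.
    exact: (@lsubspace_preimage _ _ _ i) oE.2.
  have fg0 : f \oc g = 0.
    by apply: clinP => x; rewrite /= gE; exact: fi0.
  have [h [ih _]] := uniK _ _ fg0.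
  have hE x : h x = x.
    apply: inji; have := clin_eq1 ih x.
    by rewrite /= gE.
  move=> E /(clin_open_preimage h) /topologized_open_subspace [_ [F oF FE]].
  by exists F => // x /FE; rewrite /preimage /= hE.
move=> [fi0 inji kerf embi]; split; first exact: clinP.
move=> X g fg0.
have lift x : exists y, i y = g x.
  by apply: kerf; have := clin_eq1 fg0 x.
pose h0 x := projT1 (cid (lift x)).
have h0E x : i (h0 x) = g x by exact: projT2 (cid (lift x)).
have lh0 : linear h0.
  by move=> a x y; apply: inji; rewrite h0E !linearP /= !h0E.
have [E oE|h hE] := exists_clin lh0.
  have [F oF FE] := embi _ oE.
  have [L LE] := exists_linear lh0.
  apply: open_subspaceS (clin_open_preimage g oF) _ _.
    by rewrite -(funext LE); apply: lsubspace_preimage; exact: oE.2.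
  by move=> x Fx; apply: FE; rewrite /preimage /= h0E.
exists h; split; first by apply: clinP => x; rewrite /= hE h0E.
move=> h' ih'; apply: clinP => x; apply: inji.
by rewrite hE h0E; exact: (esym (clin_eq1 ih' x)).
Qed.

(** A cokernel is an epimorphism. For the topology the test object is [C] with
    the finest topology making [p] continuous, which is separated as it refines
    that of [C]: [p] factors through it, and being epi forces the factorization
    to be the identity. In particular the image of [p] is open, so that a vector
    outside of it would be detected by a functional vanishing on the image,
    against epi. A vector of [ker p] outside an open subspace containing the
    image of [f] would be detected by a functional killing [f], hence factoring
    through [p]. *)
Lemma cokernelP A B C (p : clin B C) (f : clin A B) : is_cokernel p f <->
  [/\ forall x, p (f x) = 0, forall c, exists b, p b = c,
      forall E, open_subspace E -> (forall x, E (f x)) ->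
        forall b, p b = 0 -> E b
    & topological_quotient p].
Proof.
split=> [[/clin_eq1 pf0 uniC]|].
  have epi X (g h : clin C X) : (forall b, g (p b) = h (p b)) -> g = h.
    move=> gh; have gpf0 : (g \oc p) \oc f = 0.
      apply: clinP => x; have /= -> := pf0 x.
      by rewrite linear0.
    have [e [_ eu]] := uniC _ _ gpf0.
    rewrite -(eu g erefl); apply: eu.
    by apply: clinP => b; rewrite /= gh.
  pose quo (E : set C) := lsubspace E /\ open_subspace (p @^-1` E).
  have imp : lsubspace [set c | exists b, p b = c].
    split=> [|a _ _ [x <-] [y <-]]; first by exists 0; exact: linear0.
    by exists (a *: x + y); exact: linearP.
  have quoS E : quo E -> lsubspace E by case.
  have quoT : quo setT by split; [exact: lsubspaceT|exact: (open_subspaceT B)].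
  have quoI E E' : quo E -> quo E' -> quo (E `&` E').
    move=> [sE oE] [sE' oE']; split; first exact: lsubspaceI.
    exact: open_subspaceI.
  have quoU E E' : quo E -> lsubspace E' -> E `<=` E' -> quo E'.
    move=> [_ oE] sE' EE'; split=> //; apply: open_subspaceS oE _ _.
      exact: lsubspace_preimage.
    by move=> b /EE'.
  have quo_sep c : (forall E, quo E -> E c) -> c = 0.
    move=> quoc; apply: separated0 => E oE sE; apply: quoc; split=> //.
    exact: (clin_open_preimage p (conj oE sE)).
  pose X : TopS := topologized (SepFilter quoS quoT quoI quoU quo_sep).
  have [|E /topologized_open_subspace[]//|g gE] := @exists_clin k B X p.
    by move=> a x y; exact: (linearP p).
  have gf0 : g \oc f = 0.
    by apply: clinP => x; rewrite /= gE; exact: pf0.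
  have [h [hp _]] := uniC _ _ gf0.
  have [|E oE|j jE] := @exists_clin k X C idfun.
  - by [].
  - apply/topologized_open_subspace; split; first exact: oE.2.
    exact: clin_open_preimage.
  have jh : j \oc h = clin_id C.
    apply: epi => b; rewrite /= jE.
    by have := clin_eq1 hp b; rewrite /= gE.
  have hE c : h c = c.
    by have := clin_eq1 jh c; rewrite /= jE.
  have quop : topological_quotient p.
    move=> E sE oE; have oXE : open_subspace (E : set X).
      exact/topologized_open_subspace.
    suff -> : E = h @^-1` E by exact: (clin_open_preimage h oXE).
    by apply/seteqP; split=> c; rewrite /preimage /= hE.
  split=> //.
  - have oimp : open_subspace [set c | exists b, p b = c].
      apply: quop => //; apply: open_subspaceS (open_subspaceT _) _ _.
        exact: lsubspace_preimage.
      by move=> b _; exists b.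
    move=> c; apply: contrapT => nc.
    have [phi phi0 /eqP[]] := exists_clin_functional oimp nc.
    have -> // : phi = 0.
    by apply: epi => b; apply: phi0; exists b.
  - move=> E oE fE b pb0; apply: contrapT => nEb.
    have [phi phi0 /eqP[]] := exists_clin_functional oE nEb.
    have phif0 : phi \oc f = 0 by apply: clinP => x; exact: phi0.
    have [e [ep _]] := uniC _ _ phif0.
    by rewrite -ep /= pb0 linear0.
move=> [pf0 surjp closp quop]; split; first exact: clinP.
move=> X g gf0.
have kerp b : p b = 0 -> g b = 0.
  move=> pb0; apply: separated0 => E oE sE.
  apply: (closp (g @^-1` E) (clin_open_preimage g (conj oE sE))) pb0 => x.
  have /= gfx := clin_eq1 gf0 x.
  by rewrite /preimage /= gfx; case: sE.
pose r c := projT1 (cid (surjp c)).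
have rE c : p (r c) = c by exact: projT2 (cid (surjp c)).
have grp b : g (r (p b)) = g b.
  apply/eqP; rewrite -subr_eq0 -linearB; apply/eqP; apply: kerp.
  by rewrite linearB /= rE subrr.
have lh0 : linear (g \o r).
  move=> a x y /=; rewrite -linearP -[RHS]grp; congr (g (r _)).
  by rewrite linearP /= !rE.
have [E oE|h hE] := exists_clin lh0.
  apply: quop.
    have [L LE] := exists_linear lh0.
    by rewrite -(funext LE); apply: lsubspace_preimage; exact: oE.2.
  suff -> : p @^-1` ((g \o r) @^-1` E) = g @^-1` E by exact: clin_open_preimage.
  by apply/seteqP; split=> b; rewrite /preimage /= grp.
exists h; split; first by apply: clinP => b; rewrite /= hE /= grp.
move=> h' hp'; apply: clinP => c; rewrite hE /= -{2}[c]rE.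
exact: (esym (clin_eq1 hp' (r c))).
Qed.

End KernelsCokernels.

(** * Natural isomorphisms of endofunctors *)

Section NaturalIsomorphisms.
Context (k : fieldType).
Local Notation TopS := (sepLinTopType k).
Implicit Types F G : endofunctor k.

Definition naturally_isomorphic F G :=
  exists (eta : forall A : TopS, clin (F A) (G A))
         (theta : forall A : TopS, clin (G A) (F A)),
    [/\ forall A, cancel (eta A) (theta A), forall A, cancel (theta A) (eta A)
      & forall (A B : TopS) (f : clin A B) x,
          eta B (fmap F f x) = fmap G f (eta A x)].

Lemma natural_inverse F G (eta : forall A : TopS, clin (F A) (G A))
    (theta : forall A : TopS, clin (G A) (F A)) :
  (forall A, cancel (eta A) (theta A)) ->
  (forall A, cancel (theta A) (eta A)) ->
  (forall (A B : TopS) (f : clin A B) x,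
    eta B (fmap F f x) = fmap G f (eta A x)) ->
  forall (A B : TopS) (f : clin A B) y,
    theta B (fmap G f y) = fmap F f (theta A y).
Proof.
move=> etaK thetaK nat A B f y.
by rewrite -{1}[y]thetaK -nat etaK.
Qed.

Lemma preserves_kernels_iso F G :
  naturally_isomorphic F G -> preserves_kernels F -> preserves_kernels G.
Proof.
move=> [eta [theta [etaK thetaK nat]]] kerF K A B i f /kerF[Ffi0 uniK].
have nat' := natural_inverse etaK thetaK nat.
split.
  apply: clinP => y; rewrite /= -[y]thetaK -!nat.
  have /= -> := clin_eq1 Ffi0 (theta K y).
  by rewrite linear0.
move=> X g fg0; have [|h [hE hu]] := uniK X (theta A \oc g).
  apply: clinP => x; rewrite /= -nat'; have /= -> := clin_eq1 fg0 x.
  by rewrite linear0.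
exists (eta K \oc h); split.
  apply: clinP => x; rewrite /= -nat; have /= -> := clin_eq1 hE x.
  by rewrite thetaK.
move=> h' h'E; have -> : h = theta K \oc h'.
  apply: hu; apply: clinP => x; rewrite /= -nat'.
  by have /= -> := clin_eq1 h'E x.
by apply: clinP => x; rewrite /= thetaK.
Qed.

Lemma preserves_cokernels_iso F G :
  naturally_isomorphic F G -> preserves_cokernels F -> preserves_cokernels G.
Proof.
move=> [eta [theta [etaK thetaK nat]]] cokF A B C p f /cokF[Fpf0 uniC].
have nat' := natural_inverse etaK thetaK nat.
split.
  apply: clinP => y; rewrite /= -[y]thetaK -!nat.
  have /= -> := clin_eq1 Fpf0 (theta A y).
  by rewrite linear0.
move=> X g gf0; have [|h [hE hu]] := uniC X (g \oc eta B).
  by apply: clinP => x; rewrite /= nat; exact: (clin_eq1 gf0 (eta A x)).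
exists (h \oc theta C); split.
  apply: clinP => y; rewrite /= nat'; have /= -> := clin_eq1 hE (theta B y).
  by rewrite thetaK.
move=> h' h'E; have -> : h = h' \oc eta C.
  apply: hu; apply: clinP => x; rewrite /= nat.
  exact: (clin_eq1 h'E (eta B x)).
by apply: clinP => x; rewrite /= thetaK.
Qed.

Lemma exact_functorW F : additive_functor F ->
  preserves_kernels F -> preserves_cokernels F -> exact_functor F.
Proof.
move=> addF kerF cokF; split=> // A' A A'' i p [kip cpi].
by split; [exact: kerF|exact: cokF].
Qed.

Lemma exact_in_each_argument (T : bifunctor k) :
  in_each_argument (@additive_functor k) T ->
  in_each_argument (@preserves_kernels k) T ->
  in_each_argument (@preserves_cokernels k) T ->
  in_each_argument (@exact_functor k) T.
Proof. by move=> [aL aR] [kL kR] [cL cR]; split=> ?; apply: exact_functorW. Qed.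

Definition symmetric_bifunctor (T : bifunctor k) :=
  exists2 s : forall A B : TopS, clin (T A B) (T B A),
    forall A B, cancel (s A B) (s B A) &
    forall (A A' B B' : TopS) (f : clin A A') (g : clin B B') x,
      s A' B' (bmap T f g x) = bmap T g f (s A B x).

Lemma symmetric_fix_right (T : bifunctor k) (V : TopS) :
  symmetric_bifunctor T -> naturally_isomorphic (fix_left T V) (fix_right T V).
Proof.
move=> [s sK nat]; exists (fun A => s V A), (fun A => s A V).
by split=> [A|A|A B f x]; [exact: sK|exact: sK|exact: nat].
Qed.

End NaturalIsomorphisms.

(** * The three topologies on a tensor product *)

Section TensorTopologies.
Context (k : fieldType).

Section Slices.
Context (U V : linTopType k).

Lemma star_open_slicer (E : set (tensor U V)) u :
  star_open E -> open_subspace [set v | E (u \ox v)].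
Proof.
move=> /star_openE[sE _ /(_ u)[Q oQ QE] _].
apply: open_subspaceS oQ _ QE.
exact: (@lsubspace_preimage _ _ _ (tmul u)).
Qed.

Lemma star_open_slicel (E : set (tensor U V)) v :
  star_open E -> open_subspace [set u | E (u \ox v)].
Proof.
move=> /star_openE[sE _ _ /(_ v)[P oP PE]].
have sEv : lsubspace [set u | E (u \ox v)].
  have [L LE] := exists_linear (@tmul_linearl k U V v).
  suff -> : [set u | E (u \ox v)] = L @^-1` E by exact: lsubspace_preimage.
  by apply/seteqP; split=> u; rewrite /preimage /= LE.
exact: open_subspaceS oP sEv PE.
Qed.

End Slices.

Section Embeddings.
Context (K A V : linTopType k) (i : {linear K -> A}).
Hypothesis inji : injective i.
Hypothesis embi : topological_embedding i.

(** Each [u] has its own open condition on the second factor, hence its own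
    adapted retraction [rho u] of [i]. These do not depend linearly on [u]; so
    one keeps them on a spanning set only, and extends linearly in [u] from
    there. On [P], which may contain infinitely many vectors that are to be
    treated uniformly, the single retraction [rho0] is imposed. *)
Lemma slicewise_retraction (U : linTopType k) (E : set (tensor U K))
    (P : set U) (rho0 : {linear A -> K}) :
  lsubspace E -> (forall u, open_subspace [set v | E (u \ox v)]) ->
  lsubspace P -> cancel i rho0 ->
  (forall p, P p -> open_subspace [set a | E (p \ox rho0 a)]) ->
  exists Phi : {linear tensor U A -> tensor U K},
    [/\ forall t, Phi (tensor_map idfun i t) = t,
        forall p a, P p -> Phi (p \ox a) = p \ox rho0 a
      & forall u, exists2 R : set A, open_subspace R &
          forall a, R a -> E (Phi (u \ox a))].
Proof.
move=> sE oE sP irho0 oP.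
have rho_ex u : exists rho : {linear A -> K}, cancel i rho /\
    exists2 R : set A, open_subspace R & forall a, R a -> E (u \ox rho a).
  have [rho irho oR] := topological_embedding_retraction inji embi (oE u).
  by exists rho.
have [rho rhoP] := choice rho_ex.
(* [u] is sent to a map from [A] to the tensor product, i.e. a bilinear map is
   built in curried form. *)
pose G : set (U * (A -> tensor U K)) :=
  [set q | P q.1 /\ q.2 = fun a => q.1 \ox rho0 a].
have [||L LG span] :=
    @linear_extension_prescribed k U (A -> tensor U K) G (fun u a => u \ox rho u a).
- split=> [|c x y /= [Px xE] [Py yE]].
    by split; [case: sP|apply/funext => a; rewrite /= tmul0l].
  split; first exact: sP.2.
  by apply/funext => a; rewrite /= xE yE tmul_linearl.
- by move=> m [_ /= ->]; apply/funext => a; rewrite tmul0l.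
have LP p : P p -> L p = fun a => p \ox rho0 a by move=> Pp; exact: LG.
have span_ind (Q : set U) : lsubspace Q -> (forall p, P p -> Q p) ->
    (forall b, L b = (fun a => b \ox rho b a) -> Q b) -> forall u, Q u.
  move=> sQ QP Qb u; apply: (lspan_ind sQ _ (span u)).
  by move=> v [[m [Pv _]]|]; [exact: QP|exact: Qb].
have LD c u v a : L (c *: u + v) a = c *: L u a + L v a by rewrite linearP.
have Ll u : linear (L u).
  apply: (span_ind [set u | linear (L u)]) => [|p Pp|b Lb] /=.
  - split=> [|c x y lx ly] d a b.
      by rewrite linear0 scaler0 addr0.
    by rewrite !LD lx ly !scalerDr !scalerA (mulrC c) addrACA.
  - by rewrite LP// => c a b; rewrite !linearP.
  - by rewrite Lb => c a b'; rewrite !linearP.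
have Li u x : L u (i x) = u \ox x.
  apply: (span_ind [set u | forall x, L u (i x) = u \ox x]) => [|p Pp|b Lb] /=.
  - split=> [y|c y z Ly Lz w]; first by rewrite linear0 tmul0l.
    by rewrite LD Ly Lz tmul_linearl.
  - by move=> y; rewrite LP// irho0.
  - by move=> y; rewrite Lb; have [-> _] := rhoP b.
have LR u : exists2 R : set A, open_subspace R & forall a, R a -> E (L u a).
  apply: (span_ind [set u | exists2 R : set A, open_subspace R &
    forall a, R a -> E (L u a)]) => [|p Pp|b Lb] /=.
  - split; first by exists setT; [exact: open_subspaceT|
      move=> a _; rewrite linear0; case: sE].
    move=> c x y [R oR RE] [R' oR' RE']; exists (R `&` R').
      exact: open_subspaceI.
    by move=> a [Ra R'a]; rewrite LD; apply: sE.2; [exact: RE|exact: RE'].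
  - by rewrite LP//; exists [set a | E (p \ox rho0 a)]; [exact: oP|].
  - by rewrite Lb; have [_] := rhoP b.
have [Phi PhiE] := @exists_tensor_lift k U A _ (fun u a => L u a)
  (fun a c u v => LD c u v a) Ll.
exists Phi; split=> [t|p a Pp|u].
- apply: (tensor_linear_ext (f := Phi \o tensor_map idfun i) (g := idfun)).
  by move=> u x; rewrite /= tensor_mapE PhiE Li.
- by rewrite PhiE LP.
- by have [R oR RE] := LR u; exists R => // a Ra; rewrite PhiE; exact: RE.
Qed.

(** The retraction [rho0] imposed on [P] is adapted to the [Q] such that the
    tensors of [P] with [Q] lie in [E]; this gives the first openness condition.
    The condition at a vector of [A] only concerns small vectors of [U], which
    may be taken in [P], where the retraction is [rho0]. *)
Lemma star_embeddingr (U : linTopType k) (E : set (tensor U K)) : star_open E ->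
  exists2 F : set (tensor U A), star_open F &
    tensor_map idfun i @^-1` F `<=` E.
Proof.
move=> /[dup] oE /star_openE[sE [P [Q [oP oQ PQ]]] _ hv].
have [rho0 irho0 [R oR RQ]] := topological_embedding_retraction inji embi oQ.
have [|Phi [Phii PhiP PhiR]] :=
    slicewise_retraction sE (fun u => star_open_slicer u oE) oP.2 irho0.
  move=> p Pp; apply: open_subspaceS oR _ _ => [|a /RQ Qa]; last exact: PQ.
  exact: (@lsubspace_preimage _ _ _ (tmul p \o rho0)).
exists (Phi @^-1` E); last by move=> t; rewrite /preimage /= Phii.
apply/star_openE; split=> //; first exact: lsubspace_preimage.
- exists P, R; split=> // u a Pu /RQ Qa.
  by rewrite /preimage /= PhiP//; exact: PQ.
- move=> a; have [P' oP' P'E] := hv (rho0 a).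
  exists (P `&` P'); first exact: open_subspaceI.
  by move=> u [Pu P'u]; rewrite /preimage /= PhiP//; exact: P'E.
Qed.

(** Here [E] contains all tensors with a first factor in [P], so that any
    retraction of [i] can be imposed on [P]. *)
Lemma larrow_embeddingr (U : linTopType k) (E : set (tensor U K)) :
  larrow_open E ->
  exists2 F : set (tensor U A), larrow_open F &
    tensor_map idfun i @^-1` F `<=` E.
Proof.
move=> /[dup] oE /larrow_openE[sE [P oP PE] hu].
have [rho0 irho0] := linear_left_inverse inji.
have [|Phi [Phii PhiP PhiR]] := slicewise_retraction sE
    (fun u => star_open_slicer u (larrow_star oE)) oP.2 irho0.
  move=> p Pp; apply: open_subspaceS (open_subspaceT A) _ _ => [|a _]; last exact: PE.
  exact: (@lsubspace_preimage _ _ _ (tmul p \o rho0)).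
exists (Phi @^-1` E); last by move=> t; rewrite /preimage /= Phii.
apply/larrow_openE; split=> //; first exact: lsubspace_preimage.
by exists P => // u a Pu; rewrite /preimage /= PhiP//; exact: PE.
Qed.

Lemma larrow_embeddingl (E : set (tensor K V)) : larrow_open E ->
  exists2 F : set (tensor A V), larrow_open F &
    tensor_map i idfun @^-1` F `<=` E.
Proof.
move=> /larrow_openE[sE [P oP PE] hu].
have [rho irho [R oR RP]] := topological_embedding_retraction inji embi oP.
exists (tensor_map rho idfun @^-1` E); last first.
  by move=> t; rewrite /preimage /= (tensor_map_cancel irho).
apply/larrow_openE; split; first exact: lsubspace_preimage.
- exists R => // a v Ra; rewrite /preimage /= tensor_mapE.
  by apply: PE; exact: RP.
- move=> a; have [Q oQ QE] := hu (rho a); exists Q => // v Qv.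
  by rewrite /preimage /= tensor_mapE; exact: QE.
Qed.

Lemma shriek_embeddingr (U : linTopType k) (E : set (tensor U K)) :
  shriek_open E ->
  exists2 F : set (tensor U A), shriek_open F &
    tensor_map idfun i @^-1` F `<=` E.
Proof.
move=> /shriek_openE[sE [P [Q [oP oQ PE QE]]]].
have [rho irho [R oR RQ]] := topological_embedding_retraction inji embi oQ.
exists (tensor_map idfun rho @^-1` E); last first.
  by move=> t; rewrite /preimage /= (tensor_map_cancel _ irho).
apply/shriek_openE; split; first exact: lsubspace_preimage.
exists P, R; split=> // u a h; rewrite /preimage /= tensor_mapE.
  exact: PE.
by apply: QE; exact: RQ.
Qed.

End Embeddings.

Section Quotients.
Context (B C : linTopType k) (p : {linear B -> C}).
Hypothesis surjp : forall c, exists b, p b = c.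
Hypothesis quop : topological_quotient p.

Lemma star_quotientr (U : linTopType k) (E : set (tensor U C)) :
  lsubspace E -> star_open (tensor_map idfun p @^-1` E) -> star_open E.
Proof.
move=> sE /star_openE[_ [P [Q [oP oQ PQ]]] hu hv]; apply/star_openE.
split=> //.
- exists P, (p @` Q); split=> //; first exact: topological_quotient_image.
  move=> u _ Pu [b Qb <-].
  by have := PQ u b Pu Qb; rewrite /preimage /= tensor_mapE.
- move=> u; have [R oR RE] := hu u; exists (p @` R).
    exact: topological_quotient_image.
  by move=> _ [b Rb <-]; have := RE b Rb; rewrite /preimage /= tensor_mapE.
- move=> c; have [b <-] := surjp c; have [R oR RE] := hv b; exists R => // u Ru.
  by have := RE u Ru; rewrite /preimage /= tensor_mapE.
Qed.

Lemma larrow_quotientr (U : linTopType k) (E : set (tensor U C)) :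
  lsubspace E -> larrow_open (tensor_map idfun p @^-1` E) -> larrow_open E.
Proof.
move=> sE /larrow_openE[_ [P oP PE] hu]; apply/larrow_openE.
split=> //.
- exists P => // u c Pu; have [b <-] := surjp c.
  by have := PE u b Pu; rewrite /preimage /= tensor_mapE.
- move=> u; have [R oR RE] := hu u; exists (p @` R).
    exact: topological_quotient_image.
  by move=> _ [b Rb <-]; have := RE b Rb; rewrite /preimage /= tensor_mapE.
Qed.

Lemma larrow_quotientl (V : linTopType k) (E : set (tensor C V)) :
  lsubspace E -> larrow_open (tensor_map p idfun @^-1` E) -> larrow_open E.
Proof.
move=> sE /larrow_openE[_ [P oP PE] hu]; apply/larrow_openE.
split=> //.
- exists (p @` P); first exact: topological_quotient_image.
  move=> _ v [b Pb <-].
  by have := PE b v Pb; rewrite /preimage /= tensor_mapE.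
- move=> c; have [b <-] := surjp c; have [R oR RE] := hu b; exists R => // v Rv.
  by have := RE v Rv; rewrite /preimage /= tensor_mapE.
Qed.

Lemma shriek_quotientr (U : linTopType k) (E : set (tensor U C)) :
  lsubspace E -> shriek_open (tensor_map idfun p @^-1` E) -> shriek_open E.
Proof.
move=> sE /shriek_openE[_ [P [Q [oP oQ PE QE]]]]; apply/shriek_openE.
split=> //; exists P, (p @` Q); split=> //.
- exact: topological_quotient_image.
- move=> u c Pu; have [b <-] := surjp c.
  by have := PE u b Pu; rewrite /preimage /= tensor_mapE.
- move=> u _ [b Qb <-].
  by have := QE u b Qb; rewrite /preimage /= tensor_mapE.
Qed.

End Quotients.

Section Swap.
Context (U V : linTopType k).

Lemma star_open_swap (E : set (tensor V U)) :
  star_open E -> star_open (@tensor_swap k U V @^-1` E).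
Proof.
move=> /star_openE[sE [P [Q [oP oQ PQ]]] hu hv]; apply/star_openE.
split; first exact: lsubspace_preimage.
- exists Q, P; split=> // u v Qu Pv.
  by rewrite /preimage /= tensor_swapE; exact: PQ.
- move=> u; have [R oR RE] := hv u; exists R => // v Rv.
  by rewrite /preimage /= tensor_swapE; exact: RE.
- move=> v; have [R oR RE] := hu v; exists R => // u Ru.
  by rewrite /preimage /= tensor_swapE; exact: RE.
Qed.

Lemma shriek_open_swap (E : set (tensor V U)) :
  shriek_open E -> shriek_open (@tensor_swap k U V @^-1` E).
Proof.
move=> /shriek_openE[sE [P [Q [oP oQ PE QE]]]]; apply/shriek_openE.
split; first exact: lsubspace_preimage.
by exists Q, P; split=> // u v h; rewrite /preimage /= tensor_swapE;
  [exact: QE|exact: PE].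
Qed.

End Swap.

End TensorTopologies.

(** * Kernels and cokernels of tensor products of maps *)

Section TensorKernels.
Context (k : fieldType).
Local Notation TopS := (sepLinTopType k).
Context (U A B C : TopS).

(** The topologies enter through the one hypothesis that open subspaces are
    traces of open subspaces; the rest is exactness of the tensor product over a
    field. *)
Lemma tensor_kernelr (i : clin A B) (f : clin B C)
    (FA : sepFilter (tensor U A)) (FB : sepFilter (tensor U B))
    (FC : sepFilter (tensor U C))
    (ti : clin (topologized FA) (topologized FB))
    (tf : clin (topologized FB) (topologized FC)) :
  ti =1 tensor_map idfun i -> tf =1 tensor_map idfun f ->
  (injective i -> topological_embedding i -> forall E, FA E ->
    exists2 F, FB F & tensor_map idfun i @^-1` F `<=` E) ->
  is_kernel i f -> is_kernel ti tf.
Proof.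
move=> tiE tfE emb /kernelP[fi0 inji kerf embi]; apply/kernelP; split.
- move=> t; rewrite tiE tfE; apply: tensor_map_comp0 => u a /=.
  by rewrite fi0 linear0.
- have inj1 : injective (idfun : {linear U -> U}) by [].
  by move=> s t; rewrite !tiE; exact: (tensor_map_inj inj1 inji).
- move=> t; rewrite tfE => t0.
  have [u b h|s <-] := tensor_map_exact (f' := idfun) (g' := i) _ t0; last first.
    by exists s; rewrite tiE.
  have [a fa] : exists a, u \ox i a = u \ox b.
    case: h => [/= ->|/kerf[a <-]]; last by exists a.
    by exists 0; rewrite !tmul0l.
  by exists (u \ox a); rewrite tensor_mapE.
- move=> E /topologized_open_subspace /(emb inji embi)[F oF FE].
  exists F; first exact/topologized_open_subspace.
  by move=> t Ft; apply: FE; rewrite /preimage /= -tiE.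
Qed.

Lemma tensor_kernell (i : clin A B) (f : clin B C)
    (FA : sepFilter (tensor A U)) (FB : sepFilter (tensor B U))
    (FC : sepFilter (tensor C U))
    (ti : clin (topologized FA) (topologized FB))
    (tf : clin (topologized FB) (topologized FC)) :
  ti =1 tensor_map i idfun -> tf =1 tensor_map f idfun ->
  (injective i -> topological_embedding i -> forall E, FA E ->
    exists2 F, FB F & tensor_map i idfun @^-1` F `<=` E) ->
  is_kernel i f -> is_kernel ti tf.
Proof.
move=> tiE tfE emb /kernelP[fi0 inji kerf embi]; apply/kernelP; split.
- move=> t; rewrite tiE tfE; apply: tensor_map_comp0 => a u /=.
  by rewrite fi0 tmul0l.
- have inj1 : injective (idfun : {linear U -> U}) by [].
  by move=> s t; rewrite !tiE; exact: (tensor_map_inj inji inj1).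
- move=> t; rewrite tfE => t0.
  have [b u h|s <-] := tensor_map_exact (f' := i) (g' := idfun) _ t0; last first.
    by exists s; rewrite tiE.
  have [a fa] : exists a, i a \ox u = b \ox u.
    case: h => [/kerf[a <-]|/= ->]; first by exists a.
    by exists 0; rewrite !linear0.
  by exists (a \ox u); rewrite tensor_mapE.
- move=> E /topologized_open_subspace /(emb inji embi)[F oF FE].
  exists F; first exact/topologized_open_subspace.
  by move=> t Ft; apply: FE; rewrite /preimage /= -tiE.
Qed.

(** Openness of [E] for the star topology, the finest of the three, is enough for
    the closure condition, since it makes the sections of [E] at fixed [u]
    open. *)
Lemma tensor_cokernelr (p : clin B C) (f : clin A B)
    (FA : sepFilter (tensor U A)) (FB : sepFilter (tensor U B))
    (FC : sepFilter (tensor U C))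
    (tp : clin (topologized FB) (topologized FC))
    (tf : clin (topologized FA) (topologized FB)) :
  tp =1 tensor_map idfun p -> tf =1 tensor_map idfun f ->
  (forall E, FB E -> star_open E) ->
  ((forall c, exists b, p b = c) -> topological_quotient p -> forall E,
    lsubspace E -> FB (tensor_map idfun p @^-1` E) -> FC E) ->
  is_cokernel p f -> is_cokernel tp tf.
Proof.
move=> tpE tfE FBstar quo /cokernelP[pf0 surjp closp quop].
apply/cokernelP; split.
- move=> t; rewrite tpE tfE; apply: tensor_map_comp0 => u a /=.
  by rewrite pf0 linear0.
- have surj1 u : exists v, (idfun : {linear U -> U}) v = u by exists u.
  by move=> t; have [s <-] := tensor_map_surj surj1 surjp t; exists s.
- move=> E /topologized_open_subspace oE fE t; rewrite tpE.
  apply: tensor_map_ker => [|u b /= ->|u b pb0].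
  - exact: sepFilter_subspace oE.
  - by rewrite tmul0l; case: (sepFilter_subspace oE).
  - apply: (closp _ (star_open_slicer u (FBstar _ oE))) pb0 => a /=.
    by have := fE (u \ox a); rewrite tfE tensor_mapE.
- move=> E sE /topologized_open_subspace oE.
  apply/topologized_open_subspace; apply: quo => //.
  by move: oE; rewrite (funext tpE).
Qed.

Lemma tensor_cokernell (p : clin B C) (f : clin A B)
    (FA : sepFilter (tensor A U)) (FB : sepFilter (tensor B U))
    (FC : sepFilter (tensor C U))
    (tp : clin (topologized FB) (topologized FC))
    (tf : clin (topologized FA) (topologized FB)) :
  tp =1 tensor_map p idfun -> tf =1 tensor_map f idfun ->
  (forall E, FB E -> star_open E) ->
  ((forall c, exists b, p b = c) -> topological_quotient p -> forall E,
    lsubspace E -> FB (tensor_map p idfun @^-1` E) -> FC E) ->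
  is_cokernel p f -> is_cokernel tp tf.
Proof.
move=> tpE tfE FBstar quo /cokernelP[pf0 surjp closp quop].
apply/cokernelP; split.
- move=> t; rewrite tpE tfE; apply: tensor_map_comp0 => a u /=.
  by rewrite pf0 tmul0l.
- have surj1 u : exists v, (idfun : {linear U -> U}) v = u by exists u.
  by move=> t; have [s <-] := tensor_map_surj surjp surj1 t; exists s.
- move=> E /topologized_open_subspace oE fE t; rewrite tpE.
  apply: tensor_map_ker => [|b u pb0|b u /= ->].
  - exact: sepFilter_subspace oE.
  - apply: (closp _ (star_open_slicel u (FBstar _ oE))) pb0 => a /=.
    by have := fE (a \ox u); rewrite tfE tensor_mapE.
  - by rewrite linear0; case: (sepFilter_subspace oE).
- move=> E sE /topologized_open_subspace oE.
  apply/topologized_open_subspace; apply: quo => //.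
  by move: oE; rewrite (funext tpE).
Qed.

End TensorKernels.

(** * The three tensor product functors *)

Section TensorFunctors.
Context (k : fieldType).
Local Notation TopS := (sepLinTopType k).

Lemma exists_clin_swap (FF : forall A B : TopS, sepFilter (tensor A B)) :
  (forall (A B : TopS) E, FF B A E -> FF A B (@tensor_swap k A B @^-1` E)) ->
  exists s : forall A B, clin (topologized (FF A B)) (topologized (FF B A)),
    forall A B, s A B =1 @tensor_swap k A B.
Proof.
move=> FFswap.
have sw_ex A B : exists s : clin (topologized (FF A B)) (topologized (FF B A)),
    s =1 @tensor_swap k A B.
  apply: exists_clin => [|E /topologized_open_subspace oE].
    exact: tensor_swap_linear.
  by apply/topologized_open_subspace; exact: FFswap.
by exists (fun A B => projT1 (cid (sw_ex A B))) => A B;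
  exact: projT2 (cid (sw_ex A B)).
Qed.

Lemma tensor_star_symmetric : symmetric_bifunctor (tensor_star k).
Proof.
have [s sE] := @exists_clin_swap (@star_filter k) (fun A B => @star_open_swap k A B).
exists s => [A B t|A A' B B' f g t]; first by rewrite !sE; exact: tensor_swapK.
by rewrite !sE; exact: tensor_swap_map.
Qed.

Lemma tensor_shriek_symmetric : symmetric_bifunctor (tensor_shriek k).
Proof.
have [s sE] := @exists_clin_swap (@shriek_filter k) (fun A B => @shriek_open_swap k A B).
exists s => [A B t|A A' B B' f g t]; first by rewrite !sE; exact: tensor_swapK.
by rewrite !sE; exact: tensor_swap_map.
Qed.

Lemma tensor_star_additive :
  in_each_argument (@additive_functor k) (tensor_star k).
Proof.
by split=> U A B f g; apply: clinP; [exact: tensor_mapDr|exact: tensor_mapDl].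
Qed.

Lemma tensor_larrow_additive :
  in_each_argument (@additive_functor k) (tensor_larrow k).
Proof.
by split=> U A B f g; apply: clinP; [exact: tensor_mapDr|exact: tensor_mapDl].
Qed.

Lemma tensor_shriek_additive :
  in_each_argument (@additive_functor k) (tensor_shriek k).
Proof.
by split=> U A B f g; apply: clinP; [exact: tensor_mapDr|exact: tensor_mapDl].
Qed.

Lemma tensor_star_kernels :
  in_each_argument (@preserves_kernels k) (tensor_star k).
Proof.
have left U : preserves_kernels (fix_left (tensor_star k) U).
  move=> K A B i f; apply: tensor_kernelr => // inji embi E.
  exact: star_embeddingr.
split=> // V; apply: preserves_kernels_iso (left V).
exact: symmetric_fix_right tensor_star_symmetric.
Qed.

Lemma tensor_star_cokernels :
  in_each_argument (@preserves_cokernels k) (tensor_star k).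
Proof.
have left U : preserves_cokernels (fix_left (tensor_star k) U).
  move=> A B C p f; apply: tensor_cokernelr => // surjp quop E.
  exact: star_quotientr.
split=> // V; apply: preserves_cokernels_iso (left V).
exact: symmetric_fix_right tensor_star_symmetric.
Qed.

Lemma tensor_larrow_kernels :
  in_each_argument (@preserves_kernels k) (tensor_larrow k).
Proof.
split=> U K A B i f.
  apply: tensor_kernelr => // inji embi E; exact: larrow_embeddingr.
by apply: tensor_kernell => // inji embi E; exact: larrow_embeddingl.
Qed.

Lemma tensor_larrow_cokernels :
  in_each_argument (@preserves_cokernels k) (tensor_larrow k).
Proof.
split=> U A B C p f.
  apply: tensor_cokernelr => [//|//|E|surjp quop E]; first exact: larrow_star.
  exact: larrow_quotientr.
apply: tensor_cokernell => [//|//|E|surjp quop E]; first exact: larrow_star.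
exact: larrow_quotientl.
Qed.

Lemma tensor_shriek_kernels :
  in_each_argument (@preserves_kernels k) (tensor_shriek k).
Proof.
have left U : preserves_kernels (fix_left (tensor_shriek k) U).
  move=> K A B i f; apply: tensor_kernelr => // inji embi E.
  exact: shriek_embeddingr.
split=> // V; apply: preserves_kernels_iso (left V).
exact: symmetric_fix_right tensor_shriek_symmetric.
Qed.

Lemma tensor_shriek_cokernels :
  in_each_argument (@preserves_cokernels k) (tensor_shriek k).
Proof.
have left U : preserves_cokernels (fix_left (tensor_shriek k) U).
  move=> A B C p f; apply: tensor_cokernelr => [//|//|E oE|surjp quop E].
    exact: larrow_star (shriek_larrow oE).
  exact: shriek_quotientr.
split=> // V; apply: preserves_cokernels_iso (left V).
exact: symmetric_fix_right tensor_shriek_symmetric.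
Qed.

End TensorFunctors.

Theorem theorem12p12 (k : fieldType) :
  (* (a) *)
  (in_each_argument (@preserves_kernels k) (tensor_star k) /\
   in_each_argument (@preserves_cokernels k) (tensor_star k) /\
   in_each_argument (@exact_functor k) (tensor_star k)) /\
  (* (b) *)
  (in_each_argument (@preserves_kernels k) (tensor_larrow k) /\
   in_each_argument (@preserves_cokernels k) (tensor_larrow k) /\
   in_each_argument (@exact_functor k) (tensor_larrow k)) /\
  (* (c) *)
  (in_each_argument (@preserves_kernels k) (tensor_shriek k) /\
   in_each_argument (@preserves_cokernels k) (tensor_shriek k) /\
   in_each_argument (@exact_functor k) (tensor_shriek k)).
Proof.
split; last split.
- split; first exact: tensor_star_kernels.
  split; first exact: tensor_star_cokernels.
  exact: exact_in_each_argument (@tensor_star_additive k)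
    (@tensor_star_kernels k) (@tensor_star_cokernels k).
- split; first exact: tensor_larrow_kernels.
  split; first exact: tensor_larrow_cokernels.
  exact: exact_in_each_argument (@tensor_larrow_additive k)
    (@tensor_larrow_kernels k) (@tensor_larrow_cokernels k).
- split; first exact: tensor_shriek_kernels.
  split; first exact: tensor_shriek_cokernels.
  exact: exact_in_each_argument (@tensor_shriek_additive k)
    (@tensor_shriek_kernels k) (@tensor_shriek_cokernels k).
Qed.
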